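(* Let $f,g\in L^2(\mathbb{R}^d)$ and let $\mathcal{F}_\sigma$ be the symplectic Fourier transform. Then $$Rf(p,q)=2^{-d}\,\mathcal{F}_\sigma\big(T(f(t))(x,\omega)\big)(-p,-q).$$
   Context: For $f\in L^2(\mathbb{R}^d)$ and $x,\omega\in\mathbb{R}^d$, the Grossmann-Royer operator is $Rf(x,\omega)=R(f(t))(x,\omega)=e^{4\pi i\omega\cdot(t-x)}f(2x-t)$ and the Heisenberg-Weyl operator is $Tf(x,\omega)=T(f(t))(x,\omega)=e^{2\pi i\omega\cdot(t-\frac x2)}f(t-x)$; both are functions of the variable $t\in\mathbb{R}^d$, depending on the phase-space point $(x,\omega)$. The symplectic Fourier transform in $L^2(\mathbb{R}^{2d})$, acting in the variables $(x,\omega)$, is $$\mathcal{F}_\sigma(F(x,\omega))(p,q)=\int_{\mathbb{R}^{2d}}e^{-2\pi i\sigma((x,\omega),(p,q))}F(x,\omega)\,dx\,d\omega=\int_{\mathbb{R}^{2d}}e^{-2\pi i(\omega\cdot p-x\cdot q)}F(x,\omega)\,dx\,d\omega,$$ where $\sigma((x,\omega),(p,q))=\omega\cdot p-x\cdot q$ is the standard symplectic form on $\mathbb{R}^{2d}$.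
   Formalization: Tf is not in L²(R^{2d}) for fixed t, and directly read the sign (-p,-q) is wrong (F_σ(Tf)(-p,-q)=2^d Rf(-p,-q)); proved is the weak form <g,Rf(p,q)>=2^{-d}F_σ(<g,Tf>)(-p,-q) for a.e. (p,q), the pairing being antilinear in its second slot. *)

(* Defs.v *)
From HB Require Import structures.
From mathcomp Require Import all_boot all_order all_algebra.
From mathcomp Require Import all_classical all_reals all_analysis.
From mathcomp Require Import complex.

Set Implicit Arguments.
Unset Strict Implicit.
Unset Printing Implicit Defensive.
Import Order.TTheory GRing.Theory Num.Theory.
Import numFieldNormedType.Exports.

Local Open Scope classical_set_scope.
Local Open Scope ring_scope.
Local Open Scope complex_scope.

(* R^d, with its Borel sigma-algebra, generated by the coordinates *)
Notation Rvec R d := (d.-tuple (measurableTypeR R)).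

(* R^{2d}: pairs (x, omega) of a position and a frequency *)
Notation phase R d := (Rvec R d * Rvec R d)%type.

Section Vectors.
Context (R : realType) (d : nat).
Implicit Types (x y : Rvec R d) (z w : phase R d).

Definition coord x (i : 'I_d) : R := tnth x i.
Definition mkvec (F : 'I_d -> R) : Rvec R d :=
  [tuple (F i : measurableTypeR R) | i < d].
Definition vopp x : Rvec R d := mkvec (fun i => - coord x i).
Definition vsub x y : Rvec R d := mkvec (fun i => coord x i - coord y i).
Definition vscale (a : R) x : Rvec R d := mkvec (fun i => a * coord x i).
Definition vdot x y : R := \sum_(i < d) coord x i * coord y i.

Definition popp z : phase R d := (vopp z.1, vopp z.2).

Definition symp z w : R := vdot z.2 w.1 - vdot z.1 w.2.

End Vectors.

(* The product measure packaged as a sigma-finite measure: on \x itself this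
   instance is shadowed by the one for subprobabilities. *)
Section SigmaFiniteProduct.
Local Open Scope ereal_scope.
Context (d1 d2 : measure_display) (T1 : measurableType d1)
  (T2 : measurableType d2) (R : realType).
Context (m1 : {sigma_finite_measure set T1 -> \bar R}).
Context (m2 : {sigma_finite_measure set T2 -> \bar R}).

Definition sfprod : set (T1 * T2) -> \bar R := m1 \x m2.

HB.instance Definition _ := Measure.on sfprod.

Let sfprod_sigma_finite : sigma_finite setT sfprod.
Proof.
have /sigma_finiteP[F [TF ndF Foo]] := sigma_finiteT m1.
have /sigma_finiteP[G [TG ndG Goo]] := sigma_finiteT m2.
exists (fun n => F n `*` G n).
  rewrite -setXTT TF TG predeqE => -[x y]; split.
    move=> [/= [n _ Fnx] [k _ Gky]]; exists (maxn n k) => //; split.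
    - by move: x Fnx; exact/subsetPset/ndF/leq_maxl.
    - by move: y Gky; exact/subsetPset/ndG/leq_maxr.
  by move=> [n _ []/= ? ?]; split; exists n.
move=> k; have [? ?] := Foo k; have [? ?] := Goo k.
split; first exact: measurableX.
by rewrite /sfprod product_measure1E// lte_mul_pinfty// ge0_fin_numE.
Qed.

HB.instance Definition _ :=
  Measure_isSigmaFinite.Build _ _ _ sfprod sfprod_sigma_finite.

End SigmaFiniteProduct.

Section LebesgueMeasure.
Context (R : realType).
Local Open Scope ereal_scope.

Section Step.
Context (d : nat) (mu : {sigma_finite_measure set (Rvec R d) -> \bar R}).

Definition vcons (p : measurableTypeR R * Rvec R d) : Rvec R d.+1 :=
  [tuple of p.1 :: p.2].

Lemma measurable_vcons : measurable_fun [set: measurableTypeR R * Rvec R d] vcons.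
Proof.
exact: (@measurable_cons _ _ _ (measurableTypeR R) fst d snd).
Qed.

Definition lebesgue_step : set (Rvec R d.+1) -> \bar R :=
  pushforward (sfprod (@lebesgue_measure R) mu) vcons.

Let step0 : lebesgue_step set0 = 0.
Proof. by rewrite /lebesgue_step /pushforward preimage_set0 measure0. Qed.

Let step_ge0 A : 0 <= lebesgue_step A.
Proof. by rewrite /lebesgue_step /pushforward measure_ge0. Qed.

Let step_sigma_additive : semi_sigma_additive lebesgue_step.
Proof.
move=> F mF tF mUF; rewrite /lebesgue_step /pushforward preimage_bigcup.
apply: measure_semi_sigma_additive.
- by move=> n; rewrite -[X in measurable X]setTI; exact: measurable_vcons.
- apply/trivIsetP => /= i j _ _ ij; rewrite -preimage_setI.
  by move/trivIsetP : tF => /(_ _ _ _ _ ij) ->//; rewrite preimage_set0.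
- by rewrite -preimage_bigcup -[X in measurable X]setTI; exact: measurable_vcons.
Qed.

HB.instance Definition _ :=
  isMeasure.Build _ _ _ lebesgue_step step0 step_ge0 step_sigma_additive.

Let vuncons (x : Rvec R d.+1) : measurableTypeR R * Rvec R d :=
  (thead x, [tuple of behead x]).

Let vconsK : cancel vcons vuncons.
Proof. by case=> a x; congr (_, _); apply/val_inj. Qed.

Let step_sigma_finite : sigma_finite setT lebesgue_step.
Proof.
have [F FT Foo] := sigma_finiteT (sfprod (@lebesgue_measure R) mu).
exists (fun n => vuncons @^-1` F n).
  rewrite -preimage_bigcup; apply/esym/seteqP; split=> // x _ /=.
  by rewrite -FT.
move=> n; have [mFn Fnoo] := Foo n; split.
  rewrite -[X in measurable X]setTI.
  apply: (measurable_fun_pair (f := fun x : Rvec R d.+1 => thead x)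
    (g := fun x : Rvec R d.+1 => [tuple of behead x])) => //.
  - exact: measurable_tnth.
  - exact: measurable_behead.
rewrite /lebesgue_step /pushforward.
rewrite (_ : vcons @^-1` _ = F n)//.
by apply/seteqP; split=> p; rewrite /preimage /= vconsK.
Qed.

HB.instance Definition _ :=
  Measure_isSigmaFinite.Build _ _ _ lebesgue_step step_sigma_finite.

End Step.

Definition lebesgue_point : set (Rvec R 0) -> \bar R := \d_([tuple] : Rvec R 0).

HB.instance Definition _ := Measure.on lebesgue_point.

Let lebesgue_point_sigma_finite : sigma_finite setT lebesgue_point.
Proof.
exists (fun=> setT); first by rewrite bigcup_const.
move=> _; split; first exact: measurableT.
by rewrite /lebesgue_point diracT ltry.
Qed.

HB.instance Definition _ :=
  Measure_isSigmaFinite.Build _ _ _ lebesgue_point lebesgue_point_sigma_finite.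

(* Lebesgue measure on R^d, as the d-fold product of the one on R *)
Fixpoint lebesgue_vec (d : nat) : {sigma_finite_measure set (Rvec R d) -> \bar R} :=
  match d with
  | 0%N => lebesgue_point
  | d'.+1 => lebesgue_step (lebesgue_vec d')
  end.

Definition lebesgue_phase (d : nat) :
    {sigma_finite_measure set (phase R d) -> \bar R} :=
  sfprod (lebesgue_vec d) (lebesgue_vec d).

End LebesgueMeasure.

Section ComplexFunctions.
Context (R : realType).

Definition expi (a : R) : R[i] := cos a +i* sin a.

Context (disp : measure_display) (T : measurableType disp).
Context (mu : {measure set T -> \bar R}).

Definition cmeasurable (f : T -> R[i]) : Prop :=
  measurable_fun [set: T] (fun t => complex.Re (f t)) /\
  measurable_fun [set: T] (fun t => complex.Im (f t)).

Definition cLnorm (p : \bar R) (f : T -> R[i]) : \bar R :=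
  Lnorm mu p (fun t => (ComplexField.Normc.normc (f t))%:E).

Definition cLfun (p : \bar R) (f : T -> R[i]) : Prop :=
  cmeasurable f /\ (cLnorm p f < +oo)%E.

Definition cintegral (f : T -> R[i]) : R[i] :=
  (\int[mu]_t complex.Re (f t))%R +i* (\int[mu]_t complex.Im (f t))%R.

(* linear in f, antilinear in g *)
Definition inner (f g : T -> R[i]) : R[i] := cintegral (fun t => f t * conjc (g t)).

End ComplexFunctions.

Section TimeFrequency.
Context (R : realType) (d : nat).

Definition grossmann_royer (f : Rvec R d -> R[i]) (z : phase R d)
    (t : Rvec R d) : R[i] :=
  expi (4 * pi * vdot z.2 (vsub t z.1)) * f (vsub (vscale 2 z.1) t).

Definition heisenberg_weyl (f : Rvec R d -> R[i]) (z : phase R d)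
    (t : Rvec R d) : R[i] :=
  expi (2 * pi * vdot z.2 (vsub t (vscale 2^-1 z.1))) * f (vsub t z.1).

Definition symplectic_fourier_int (F : phase R d -> R[i]) (w : phase R d) : R[i] :=
  cintegral (lebesgue_phase R d) (fun z => expi (- (2 * pi * symp z w)) * F z).

(* H represents the image of F under the continuous extension to L^2(R^{2d}) of
   the integral transform on L^1 `&` L^2. *)
Definition is_symplectic_fourier (F H : phase R d -> R[i]) : Prop :=
  [/\ cLfun (lebesgue_phase R d) 2%:E F, cLfun (lebesgue_phase R d) 2%:E H &
   exists u : nat -> phase R d -> R[i],
   [/\ forall n, cLfun (lebesgue_phase R d) 1%:E (u n) /\
                 cLfun (lebesgue_phase R d) 2%:E (u n),
       cLnorm (lebesgue_phase R d) 2%:E (fun z => u n z - F z) @[n --> \oo] --> 0%E &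
       cLnorm (lebesgue_phase R d) 2%:E
         (fun w => symplectic_fourier_int (u n) w - H w) @[n --> \oo] --> 0%E]].

(* A representative, determined up to a null set, of the symplectic Fourier
   transform of F in L^2(R^{2d}); the value 0 is only a default for F outside
   L^2(R^{2d}). *)
Definition symplectic_fourier (F : phase R d -> R[i]) : phase R d -> R[i] :=
  xget (fun=> 0) [set H | is_symplectic_fourier F H].

End TimeFrequency.

(* Main.v *)
Require Import Defs.
From mathcomp Require Import all_boot all_order all_algebra.
From mathcomp Require Import all_classical all_reals all_analysis.
From mathcomp Require Import complex.
From mathcomp Require Import measurable_realfun ring lra.
Set Implicit Arguments.
Unset Strict Implicit.
Unset Printing Implicit Defensive.
Import Order.TTheory GRing.Theory Num.Theory.
Import numFieldNormedType.Exports.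
Local Open Scope classical_set_scope.
Local Open Scope ring_scope.

(** Put [h_x(t) = g(t) conj(f(t - x))]. Up to a unimodular factor, [<g, Tf(x, .)>]
    is the Fourier transform of [h_x]; on the other side, the substitution
    [t = x/2 - p] turns [H(p, q) = 2^d <g, Rf(-p, -q)>] into the inverse Fourier
    transform in [x], at [q], of [x |-> h_x(x/2 - p)]. Since the pairing is antilinear
    in its second argument, the kernels are conjugated, whence the sign in [F_sigma].

    For [u] in [L^1 /\ L^2] the symplectic transform of [u] is a Fourier transform in
    [omega] followed by an inverse one in [x]. Plancherel and [L^2]-inversion, applied
    one variable at a time, give [|F_sigma u - H|_2 <= |u - <g, Tf>|_2]; truncations
    of [<g, Tf>] to sets of finite measure then exhibit [H] as its symplectic transform,
    and Plancherel on phase space shows that there is no other one up to null sets.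

    Plancherel on the line: damping by [exp(-e |w|)], whose transform is the Poisson
    kernel (nonnegative, of mass 1), yields a contraction, and equality for continuous
    functions of compact support; these are dense. Fubini's theorem passes the
    statement to products. Inversion is then a formal consequence: an isometry [F'] with
    [<F' k, h> = <k, F h>] and [F] isometric satisfies [|F' k - h| = |k - F h|]. *)

(** * Complex-valued integrals *)

(** For fixed [t] the modulus of [Tf(x, omega)(t)] does not depend on [omega], so for [d > 0] this
    function of the phase-space point is in [L^2] only when it vanishes almost everywhere: the
    operator identity has to be tested against [g]. Even then [<g, Tf>] is square integrable but in
    general not integrable, hence the approximating sequence and a conclusion that holds almost
    everywhere.

    Integrals return junk values on functions that are not integrable, so linearity and Fubini are
    used only where integrability is established. The sections [h_x] are integrable for every [x],
    by Cauchy-Schwarz, but known to be square integrable only for almost every [x]: the transforms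
    make sense everywhere, Plancherel is applied almost everywhere.

    The exponential damping is chosen because its transform is a rational function with an
    elementary derivation: an explicit primitive gives the kernel and an arctangent integral gives
    its mass. The factor [2^d] is the Jacobian of [t = x/2 - p]. *)

Section ComplexAlgebra.
Context {R : realType}.
Implicit Types z w : R[i].
Local Notation Re := complex.Re.
Local Notation Im := complex.Im.

(** The squared modulus, kept polynomial in the two parts so that [ring] and [nra] apply; [normc]
    would bring in a square root. *)
Definition sqn z : R := Re z ^+ 2 + Im z ^+ 2.

Lemma complexP z w : Re z = Re w -> Im z = Im w -> z = w.
Proof. by case: z w => [a b] [c d] /= -> ->. Qed.

Lemma ReD z w : Re (z + w) = Re z + Re w. Proof. by case: z w => [a b] [c d]. Qed.
Lemma ImD z w : Im (z + w) = Im z + Im w. Proof. by case: z w => [a b] [c d]. Qed.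
Lemma ReN z : Re (- z) = - Re z. Proof. by case: z. Qed.
Lemma ImN z : Im (- z) = - Im z. Proof. by case: z. Qed.
Lemma ReM z w : Re (z * w) = Re z * Re w - Im z * Im w.
Proof. by case: z w => [a b] [c d]. Qed.
Lemma ImM z w : Im (z * w) = Re z * Im w + Im z * Re w.
Proof. by case: z w => [a b] [c d]. Qed.
Lemma ReJ z : Re (conjc z) = Re z. Proof. by case: z. Qed.
Lemma ImJ z : Im (conjc z) = - Im z. Proof. by case: z. Qed.
Lemma Re0 : Re (0 : R[i]) = 0. Proof. by []. Qed.
Lemma Im0 : Im (0 : R[i]) = 0. Proof. by []. Qed.
Lemma Re_expi a : Re (expi a : R[i]) = cos a. Proof. by []. Qed.
Lemma Im_expi a : Im (expi a : R[i]) = sin a. Proof. by []. Qed.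
Lemma ReR (a : R) : Re (real_complex R a) = a. Proof. by []. Qed.
Lemma ImR (a : R) : Im (real_complex R a) = 0. Proof. by []. Qed.

Definition complexE := (ReD, ImD, ReN, ImN, ReM, ImM, ReJ, ImJ, Re0, Im0, ReR, ImR).

Lemma expiD (a b : R) : expi (a + b) = expi a * expi b.
Proof.
by apply: complexP; rewrite !complexE /= ?cosD ?sinD//; ring.
Qed.

Lemma expi0 : expi 0 = 1 :> R[i].
Proof. by rewrite /expi cos0 sin0. Qed.

Lemma conj_expi (a : R) : conjc (expi a) = expi (- a).
Proof. by rewrite /expi /= cosN sinN. Qed.

Lemma sqn_ge0 z : 0 <= sqn z. Proof. by rewrite addr_ge0 ?sqr_ge0. Qed.

Lemma sqnM z w : sqn (z * w) = sqn z * sqn w.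
Proof. by rewrite /sqn !complexE; ring. Qed.

Lemma sqnJ z : sqn (conjc z) = sqn z.
Proof. by rewrite /sqn !complexE sqrrN. Qed.

Lemma sqnN z : sqn (- z) = sqn z.
Proof. by rewrite /sqn !complexE !sqrrN. Qed.

Lemma sqn_expi (a : R) : sqn (expi a) = 1. Proof. exact: cos2Dsin2. Qed.

Lemma sqn0 : sqn 0 = 0. Proof. by rewrite /sqn /= expr0n /= addr0. Qed.

Lemma sqn_eq0 z : sqn z = 0 -> z = 0.
Proof.
move=> /eqP; rewrite /sqn paddr_eq0 ?sqr_ge0// !sqrf_eq0 => /andP[/eqP a /eqP b].
exact: complexP.
Qed.

(** Parallelogram law: the deficit is [sqn (z - w)]. *)
Lemma sqnD_le z w : sqn (z + w) <= 2 * sqn z + 2 * sqn w.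
Proof.
rewrite -subr_ge0 (_ : _ - _ = (Re z - Re w) ^+ 2 + (Im z - Im w) ^+ 2).
  by rewrite addr_ge0 ?sqr_ge0.
by rewrite /sqn !complexE; ring.
Qed.

Lemma normcE z : ComplexField.Normc.normc z = Num.sqrt (sqn z).
Proof. by case: z. Qed.

Lemma normc_ge0 z : 0 <= ComplexField.Normc.normc z.
Proof. by rewrite normcE sqrtr_ge0. Qed.

Lemma normc_sqr z : ComplexField.Normc.normc z ^+ 2 = sqn z.
Proof. by rewrite normcE sqr_sqrtr ?sqn_ge0. Qed.

Lemma normRe_le z : `|Re z| <= ComplexField.Normc.normc z.
Proof. by rewrite normcE -sqrtr_sqr ler_sqrt ?sqn_ge0// lerDl sqr_ge0. Qed.

Lemma normIm_le z : `|Im z| <= ComplexField.Normc.normc z.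
Proof. by rewrite normcE -sqrtr_sqr ler_sqrt ?sqn_ge0// lerDr sqr_ge0. Qed.

Lemma normc_le z : ComplexField.Normc.normc z <= `|Re z| + `|Im z|.
Proof.
rewrite -(@ler_pXn2r _ 2) ?nnegrE ?normc_ge0 ?addr_ge0// normc_sqr /sqn.
rewrite -(real_normK (num_real (Re z))) -(real_normK (num_real (Im z))) sqrrD.
rewrite lerD2r lerDl mulrn_wge0//; exact: mulr_ge0.
Qed.

(** A crude form of the inequality between the geometric and the arithmetic mean; it serves only to
    make products of square integrable functions integrable. *)
Lemma normReM_le z w : `|Re (z * w)| <= sqn z + sqn w.
Proof.
have := sqr_ge0 (Re z - Re w); have := sqr_ge0 (Re z + Re w).
have := sqr_ge0 (Im z - Im w); have := sqr_ge0 (Im z + Im w).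
by rewrite ler_norml /sqn complexE => *; apply/andP; split; nra.
Qed.

Lemma normImM_le z w : `|Im (z * w)| <= sqn z + sqn w.
Proof.
have := sqr_ge0 (Re z - Im w); have := sqr_ge0 (Re z + Im w).
have := sqr_ge0 (Im z - Re w); have := sqr_ge0 (Im z + Re w).
by rewrite ler_norml /sqn complexE => *; apply/andP; split; nra.
Qed.

(** Here the sharp constant matters: it is what gives the damped Fourier transform the bound 1. *)
Lemma normRe_mulJ_le z w : `|Re (z * conjc w)| <= 2^-1 * (sqn z + sqn w).
Proof.
have := sqr_ge0 (Re z - Re w); have := sqr_ge0 (Re z + Re w).
have := sqr_ge0 (Im z - Im w); have := sqr_ge0 (Im z + Im w).
by rewrite ler_norml /sqn !complexE => *; apply/andP; split; nra.
Qed.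

End ComplexAlgebra.

(** * Measurability of complex-valued functions *)

Section ComplexMeasurability.
Context d (T : measurableType d) {R : realType}.
Implicit Types f g : T -> R[i].

Lemma cmeasurableM f g : cmeasurable f -> cmeasurable g ->
  cmeasurable (fun x => f x * g x).
Proof.
move=> [f1 f2] [g1 g2]; split.
  under eq_fun do rewrite ReM.
  by apply: measurable_funB; apply: measurable_funM.
under eq_fun do rewrite ImM.
by apply: measurable_funD; apply: measurable_funM.
Qed.

Lemma cmeasurableD f g : cmeasurable f -> cmeasurable g ->
  cmeasurable (fun x => f x + g x).
Proof.
move=> [f1 f2] [g1 g2]; split.
  by under eq_fun do rewrite ReD; apply: measurable_funD.
by under eq_fun do rewrite ImD; apply: measurable_funD.
Qed.

Lemma cmeasurableN f : cmeasurable f -> cmeasurable (fun x => - f x).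
Proof.
move=> [f1 f2]; split.
  by under eq_fun do rewrite ReN; exact: measurable_funN.
by under eq_fun do rewrite ImN; exact: measurable_funN.
Qed.

Lemma cmeasurableB f g : cmeasurable f -> cmeasurable g ->
  cmeasurable (fun x => f x - g x).
Proof. by move=> mf mg; apply: cmeasurableD => //; exact: cmeasurableN. Qed.

Lemma cmeasurableJ f : cmeasurable f -> cmeasurable (fun x => conjc (f x)).
Proof.
move=> [f1 f2]; split; first by under eq_fun do rewrite ReJ.
by under eq_fun do rewrite ImJ; exact: measurable_funN.
Qed.

Lemma cmeasurable_expi (h : T -> R) : measurable_fun setT h ->
  cmeasurable (fun x => expi (h x)).
Proof.
move=> mh; split.
  by under eq_fun do rewrite Re_expi; apply: measurableT_comp => //;
    apply: continuous_measurable_fun; exact: continuous_cos.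
by under eq_fun do rewrite Im_expi; apply: measurableT_comp => //;
  apply: continuous_measurable_fun; exact: continuous_sin.
Qed.

Lemma cmeasurable_real (h : T -> R) : measurable_fun setT h ->
  cmeasurable (fun x => real_complex R (h x)).
Proof. by move=> mh; split; [exact: mh|exact: (measurable_cst (0 : R))]. Qed.

Lemma cmeasurable_cst (c : R[i]) : cmeasurable (fun _ : T => c).
Proof. by split; [exact: (measurable_cst (complex.Re c))|exact: (measurable_cst (complex.Im c))]. Qed.

Lemma cmeasurable_comp d' (T' : measurableType d') (phi : T' -> T) f :
  measurable_fun setT phi -> cmeasurable f -> cmeasurable (fun x => f (phi x)).
Proof. by move=> mp [f1 f2]; split; [exact: (measurableT_comp f1 mp)|exact: (measurableT_comp f2 mp)]. Qed.

Lemma measurable_sqn f : cmeasurable f ->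
  measurable_fun setT (fun x => sqn (f x)).
Proof. by move=> [f1 f2]; apply: measurable_funD; exact: measurable_funX. Qed.

Lemma measurable_normc f : cmeasurable f ->
  measurable_fun setT (fun x => ComplexField.Normc.normc (f x)).
Proof.
move=> mf; under eq_fun do rewrite normcE.
apply: measurableT_comp; last exact: measurable_sqn.
by apply: continuous_measurable_fun; exact: sqrt_continuous.
Qed.

End ComplexMeasurability.

(** * Complex integrals and squared [L^2] norms *)

Section ComplexIntegral.
Context d (T : measurableType d) {R : realType} (mu : {measure set T -> \bar R}).
Implicit Types f g : T -> R[i].
Local Notation Re := complex.Re.
Local Notation Im := complex.Im.
Local Notation normc := ComplexField.Normc.normc.

Definition cintegrable f : Prop :=
  mu.-integrable setT (EFin \o (fun x => Re (f x))) /\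
  mu.-integrable setT (EFin \o (fun x => Im (f x))).

Lemma cintegrable_measurable f : cintegrable f -> cmeasurable f.
Proof. by move=> [] /measurable_int/measurable_EFinP ? /measurable_int/measurable_EFinP. Qed.

Lemma cintegrable_le f (h : T -> \bar R) : cmeasurable f ->
  mu.-integrable setT h -> (forall x, (normc (f x))%:E <= h x)%E -> cintegrable f.
Proof.
move=> [mf1 mf2] ih fh.
have h0 x : (0 <= h x)%E by rewrite (le_trans _ (fh x))// lee_fin normc_ge0.
split; apply: le_integrable ih => //; try exact/measurable_EFinP.
  move=> x _ /=; rewrite gee0_abs// (le_trans _ (fh x))// lee_fin.
  exact: normRe_le.
move=> x _ /=; rewrite gee0_abs// (le_trans _ (fh x))// lee_fin.
exact: normIm_le.
Qed.

Lemma cintegrableP f : cintegrable f <->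
  cmeasurable f /\ (\int[mu]_x (normc (f x))%:E < +oo)%E.
Proof.
split=> [fi|[mf fi]].
  have mf := cintegrable_measurable fi; split => //.
  case: fi => fi1 fi2.
  have : mu.-integrable setT ((abse \o (EFin \o (fun x => Re (f x)))) \+
     (abse \o (EFin \o (fun x => Im (f x)))))%E.
    by apply: integrableD => //; exact: integrable_abse.
  move=> /integrableP[_]; apply: le_lt_trans; apply: ge0_le_integral => //.
  - by move=> x _; rewrite lee_fin normc_ge0.
  - exact/measurable_EFinP/measurable_normc.
  - apply: measurableT_comp => //; apply: emeasurable_funD;
      apply: measurableT_comp => //; apply/measurable_EFinP; apply mf.
  - move=> x _ /=; rewrite lee_fin (le_trans (normc_le _))//.
    exact: ler_norm.
apply: (@cintegrable_le f (fun x => (normc (f x))%:E)) => //.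
apply/integrableP; split; first exact/measurable_EFinP/measurable_normc.
by under eq_integral => x _ do rewrite gee0_abs ?lee_fin ?normc_ge0//.
Qed.

Lemma cintegralD f g : cintegrable f -> cintegrable g ->
  cintegral mu (fun x => f x + g x) = cintegral mu f + cintegral mu g.
Proof.
move=> [f1 f2] [g1 g2]; apply: complexP; rewrite !complexE /=.
  by rewrite -RintegralD//; congr Rintegral; apply/funext => x; rewrite complexE.
by rewrite -RintegralD//; congr Rintegral; apply/funext => x; rewrite complexE.
Qed.

Lemma cintegrableD f g : cintegrable f -> cintegrable g ->
  cintegrable (fun x => f x + g x).
Proof.
move=> [f1 f2] [g1 g2]; split.
  rewrite (_ : _ \o _ = (EFin \o (fun x => Re (f x))) \+ (EFin \o (fun x => Re (g x))))%E.
    exact: integrableD.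
  by apply/funext => x /=; rewrite complexE.
rewrite (_ : _ \o _ = (EFin \o (fun x => Im (f x))) \+ (EFin \o (fun x => Im (g x))))%E.
  exact: integrableD.
by apply/funext => x /=; rewrite complexE.
Qed.

Lemma cintegrableZ (c : R[i]) f : cintegrable f -> cintegrable (fun x => c * f x).
Proof.
move=> [f1 f2]; split.
  rewrite (_ : _ \o _ = (fun x => (Re c)%:E * (EFin \o (fun x => Re (f x))) x) \-
     (fun x => (Im c)%:E * (EFin \o (fun x => Im (f x))) x))%E.
    by apply: integrableB => //; exact: integrableZl.
  by apply/funext => x /=; rewrite complexE.
rewrite (_ : _ \o _ = (fun x => (Re c)%:E * (EFin \o (fun x => Im (f x))) x) \+
   (fun x => (Im c)%:E * (EFin \o (fun x => Re (f x))) x))%E.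
  by apply: integrableD => //; exact: integrableZl.
by apply/funext => x /=; rewrite complexE.
Qed.

Lemma cintegralZ (c : R[i]) f : cintegrable f ->
  cintegral mu (fun x => c * f x) = c * cintegral mu f.
Proof.
move=> [f1 f2].
have iZ (k : R) (u : T -> R) : mu.-integrable setT (EFin \o u) ->
    mu.-integrable setT (EFin \o (fun x => k * u x)).
  by move=> iu; rewrite (_ : _ \o _ = (fun x => k%:E * (EFin \o u) x)%E)//;
    exact: integrableZl.
apply: complexP; rewrite !complexE /=.
  by rewrite -!RintegralZl// -RintegralB//; [congr Rintegral; apply/funext => x;
    rewrite complexE|exact: iZ|exact: iZ].
by rewrite -!RintegralZl// -RintegralD//; [congr Rintegral; apply/funext => x;
  rewrite complexE|exact: iZ|exact: iZ].
Qed.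

Lemma cintegralB f g : cintegrable f -> cintegrable g ->
  cintegral mu (fun x => f x - g x) = cintegral mu f - cintegral mu g.
Proof.
move=> fi gi.
rewrite (_ : (fun x => _) = (fun x => f x + (-1) * g x)).
  by rewrite cintegralD ?cintegralZ ?mulN1r//; exact: cintegrableZ.
by apply/funext => x; rewrite mulN1r.
Qed.

Lemma cintegrableB f g : cintegrable f -> cintegrable g ->
  cintegrable (fun x => f x - g x).
Proof.
move=> fi gi.
rewrite (_ : (fun x => _) = (fun x => f x + (-1) * g x)).
  by apply: cintegrableD => //; exact: cintegrableZ.
by apply/funext => x; rewrite mulN1r.
Qed.

Lemma cintegralJ f : cintegrable f ->
  cintegral mu (fun x => conjc (f x)) = conjc (cintegral mu f).
Proof.
move=> [f1 f2]; apply: complexP; rewrite !complexE /=.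
  by congr Rintegral; apply/funext => x; rewrite complexE.
rewrite -mulN1r -RintegralZl//.
by congr Rintegral; apply/funext => x; rewrite complexE mulN1r.
Qed.

Lemma cintegrableJ f : cintegrable f -> cintegrable (fun x => conjc (f x)).
Proof.
move=> [f1 f2]; split.
  by rewrite (_ : _ \o _ = EFin \o (fun x => Re (f x)))//; apply/funext => x /=; rewrite complexE.
rewrite (_ : _ \o _ = \- (EFin \o (fun x => Im (f x))))%E; first exact: integrableN.
by apply/funext => x /=; rewrite complexE.
Qed.

Lemma cintegrableM_le1 f (a : T -> R[i]) : cmeasurable a ->
  (forall x, sqn (a x) <= 1) -> cintegrable f -> cintegrable (fun x => a x * f x).
Proof.
move=> ma a1 /cintegrableP[mf fi]; apply/cintegrableP; split.
  exact: cmeasurableM.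
apply: le_lt_trans fi; apply: ge0_le_integral => //.
- by move=> x _; rewrite lee_fin normc_ge0.
- exact/measurable_EFinP/measurable_normc/cmeasurableM.
- exact/measurable_EFinP/measurable_normc.
- move=> x _; rewrite lee_fin !normcE ler_sqrt ?sqn_ge0// sqnM ler_piMl ?sqn_ge0//.
Qed.

Lemma cintegrable_expiM f (h : T -> R) : measurable_fun setT h ->
  cintegrable f -> cintegrable (fun x => expi (h x) * f x).
Proof.
move=> mh fi; apply: cintegrableM_le1 => //; first exact: cmeasurable_expi.
by move=> x; rewrite sqn_expi.
Qed.

(** The squared [L^2] norm, with values in [\bar R]. Unlike the norm, it is an iterated integral by
    Tonelli, which lets Plancherel act on one variable at a time. *)
Definition N2 f : \bar R := (\int[mu]_x (sqn (f x))%:E)%E.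

Lemma N2_ge0 f : (0 <= N2 f)%E.
Proof. by apply: integral_ge0 => x _; rewrite lee_fin sqn_ge0. Qed.

Lemma le_N2 f g : cmeasurable f -> cmeasurable g ->
  (forall x, sqn (f x) <= sqn (g x)) -> (N2 f <= N2 g)%E.
Proof.
move=> mf mg fg; apply: ge0_le_integral => //.
- by move=> x _; rewrite lee_fin sqn_ge0.
- exact/measurable_EFinP/measurable_sqn.
- exact/measurable_EFinP/measurable_sqn.
- by move=> x _; rewrite lee_fin.
Qed.

(** Stands in for Minkowski's inequality; the factor 2 is harmless wherever terms only have to be
    finite or to tend to zero. *)
Lemma N2D_le f g : cmeasurable f -> cmeasurable g ->
  (N2 (fun x => (f x + g x)%R) <= 2%:E * N2 f + 2%:E * N2 g)%E.
Proof.
move=> mf mg.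
have m1 h : cmeasurable h -> measurable_fun setT (fun x => (sqn (h x))%:E).
  by move=> mh; exact/measurable_EFinP/measurable_sqn.
have m2 h : cmeasurable h -> measurable_fun setT (fun x => 2%:E * (sqn (h x))%:E)%E.
  by move=> mh; apply: measurable_funeM; exact: m1.
rewrite /N2 -!ge0_integralZl//; try exact: m1; try by move=> x _; rewrite lee_fin sqn_ge0.
rewrite -ge0_integralD//; try exact: m2; try by move=> x _; rewrite -EFinM lee_fin mulr_ge0// sqn_ge0.
apply: ge0_le_integral => //.
- by move=> x _; rewrite lee_fin sqn_ge0.
- exact/m1/cmeasurableD.
- by apply: emeasurable_funD; exact: m2.
- by move=> x _; rewrite -!EFinM -EFinD lee_fin; exact: sqnD_le.
Qed.

Lemma N2N f : N2 (fun x => - f x) = N2 f.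
Proof. by apply: eq_integral => x _; rewrite sqnN. Qed.

Lemma N2B_le f g : cmeasurable f -> cmeasurable g ->
  (N2 (fun x => (f x - g x)%R) <= 2%:E * N2 f + 2%:E * N2 g)%E.
Proof.
by move=> mf mg; rewrite -(N2N g); apply: N2D_le => //; exact: cmeasurableN.
Qed.

Lemma N2D_lty f g : cmeasurable f -> cmeasurable g -> (N2 f < +oo)%E ->
  (N2 g < +oo)%E -> (N2 (fun x => (f x + g x)%R) < +oo)%E.
Proof.
move=> mf mg f2 g2; apply: (le_lt_trans (N2D_le mf mg)).
by rewrite lte_add_pinfty// lte_mul_pinfty.
Qed.

Lemma N2B_lty f g : cmeasurable f -> cmeasurable g -> (N2 f < +oo)%E ->
  (N2 g < +oo)%E -> (N2 (fun x => (f x - g x)%R) < +oo)%E.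
Proof.
by move=> mf mg f2 g2; apply: N2D_lty => //; [exact: cmeasurableN|rewrite N2N].
Qed.

Lemma integrable_sqn f : cmeasurable f -> (N2 f < +oo)%E ->
  mu.-integrable setT (fun x => (sqn (f x))%:E).
Proof.
move=> mf f2; apply/integrableP; split; first exact/measurable_EFinP/measurable_sqn.
by under eq_integral => x _ do rewrite gee0_abs ?lee_fin ?sqn_ge0//.
Qed.

Lemma cintegrable_N2M f g : cmeasurable f -> cmeasurable g -> (N2 f < +oo)%E ->
  (N2 g < +oo)%E -> cintegrable (fun x => f x * g x).
Proof.
move=> mf mg f2 g2.
have ifg : mu.-integrable setT (fun x => (sqn (f x))%:E + (sqn (g x))%:E)%E.
  by apply: integrableD => //; exact: integrable_sqn.
have mfg := cmeasurableM mf mg.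
split; apply: le_integrable ifg => //; try by apply/measurable_EFinP; apply mfg.
  move=> x _ /=; rewrite lee_fin (ger0_norm (addr_ge0 _ _)) ?sqn_ge0//.
  exact: normReM_le.
move=> x _ /=; rewrite lee_fin (ger0_norm (addr_ge0 _ _)) ?sqn_ge0//.
exact: normImM_le.
Qed.

Lemma N2_ae_eq0 f : cmeasurable f -> N2 f = 0%E -> {ae mu, forall x, f x = 0}.
Proof.
move=> mf f0.
have /(ae_eq_integral_abs mu measurableT) : measurable_fun setT (fun x => (sqn (f x))%:E).
  exact/measurable_EFinP/measurable_sqn.
move=> [H _]; apply: filterS (H _).
  by move=> x /= /(_ I) [] /sqn_eq0.
by rewrite -f0; apply: eq_integral => x _; rewrite gee0_abs// lee_fin sqn_ge0.
Qed.

Lemma cLnorm2E f : (cLnorm mu 2%:E f = N2 f `^ 2^-1)%E.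
Proof.
rewrite /cLnorm unlock; congr (_ `^ _)%E; apply: eq_integral => x _ /=.
by rewrite (powR_mulrn 2) ?normr_ge0// ger0_norm ?normc_ge0// normc_sqr.
Qed.

Lemma cLfun2P f : cLfun mu 2%:E f <-> cmeasurable f /\ (N2 f < +oo)%E.
Proof.
rewrite /cLfun cLnorm2E; split=> -[mf f2]; split => //.
  by move: f2; exact: lty_poweRy.
exact: poweR_lty.
Qed.

Lemma cLfun1P f : cLfun mu 1%:E f <-> cintegrable f.
Proof.
rewrite cintegrableP /cLfun /cLnorm Lnorm1.
by under eq_integral => x _ do rewrite gee0_abs ?lee_fin ?normc_ge0//.
Qed.

(** Passes between the norm of the definitions and [N2]: a product of two null sequences in one
    direction, continuity of the square root in the other. *)
Lemma cLnorm2_cvg0 (u : nat -> T -> R[i]) :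
  cLnorm mu 2%:E (u n) @[n --> \oo] --> 0%E <-> N2 (u n) @[n --> \oo] --> 0%E.
Proof.
under eq_fun do rewrite cLnorm2E.
split=> /fine_cvgP[ufin u0]; apply/fine_cvgP; split.
- apply: filterS ufin => n; rewrite !fin_numElt => /andP[_].
  move=> h; rewrite (lty_poweRy _ h)// ?invr_eq0// andbT.
  by rewrite (lt_le_trans _ (N2_ge0 _)).
- rewrite -[X in _ --> X](mulr0 0).
  rewrite (_ : _ \o _ = ((fine \o (fun n => (N2 (u n) `^ 2^-1)%E)) \*
      (fine \o (fun n => (N2 (u n) `^ 2^-1)%E)))); first by apply: cvgM; exact: u0.
  apply/funext => n /=; rewrite fine_poweR powR12_sqrt; last exact/fine_ge0/N2_ge0.
  by rewrite -expr2 sqr_sqrtr//; exact/fine_ge0/N2_ge0.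
- by apply: filterS ufin => n /= h; rewrite fin_num_poweR.
- rewrite -[X in _ --> X](sqrtr0 R) (_ : _ \o _ = fun n => Num.sqrt ((fine \o (fun n => N2 (u n))) n)).
    by apply: continuous_cvg; [exact: sqrt_continuous|exact: u0].
  by apply/funext => n /=; rewrite fine_poweR powR12_sqrt//; exact/fine_ge0/N2_ge0.
Qed.

End ComplexIntegral.

(** * Tonelli and Fubini for complex-valued functions *)

Section Product.
Context d1 d2 (T1 : measurableType d1) (T2 : measurableType d2) {R : realType}.
Context (m1 : {sigma_finite_measure set T1 -> \bar R}).
Context (m2 : {sigma_finite_measure set T2 -> \bar R}).
Local Notation Re := complex.Re.
Local Notation Im := complex.Im.
Local Notation normc := ComplexField.Normc.normc.
Implicit Types F : T1 * T2 -> R[i].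

Lemma cmeasurable_pair1 F x : cmeasurable F -> cmeasurable (fun y => F (x, y)).
Proof. exact: (cmeasurable_comp (pair1_measurable x)). Qed.

Lemma N2_prod1 F : cmeasurable F ->
  N2 (sfprod m1 m2) F = (\int[m1]_x N2 m2 (fun y => F (x, y)))%E.
Proof.
move=> mF; rewrite /N2 /sfprod (fubini_tonelli1 (fun z => (sqn (F z))%:E))//.
  exact/measurable_EFinP/measurable_sqn.
by move=> z; rewrite lee_fin sqn_ge0.
Qed.

Lemma N2_prod2 F : cmeasurable F ->
  N2 (sfprod m1 m2) F = (\int[m2]_y N2 m1 (fun x => F (x, y)))%E.
Proof.
move=> mF; rewrite /N2 /sfprod (fubini_tonelli2 (fun z => (sqn (F z))%:E))//.
  exact/measurable_EFinP/measurable_sqn.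
by move=> z; rewrite lee_fin sqn_ge0.
Qed.

Lemma measurable_N2_pair1 F : cmeasurable F ->
  measurable_fun setT (fun x => N2 m2 (fun y => F (x, y))).
Proof.
move=> mF; apply: (measurable_fun_fubini_tonelli_F (fun z => (sqn (F z))%:E)).
  exact/measurable_EFinP/measurable_sqn.
by move=> z; rewrite lee_fin sqn_ge0.
Qed.

Lemma measurable_N2_pair2 F : cmeasurable F ->
  measurable_fun setT (fun y => N2 m1 (fun x => F (x, y))).
Proof.
move=> mF; apply: (measurable_fun_fubini_tonelli_G (fun z => (sqn (F z))%:E)).
  exact/measurable_EFinP/measurable_sqn.
by move=> z; rewrite lee_fin sqn_ge0.
Qed.

Lemma ae_N2_lty1 F : cmeasurable F -> (N2 (sfprod m1 m2) F < +oo)%E ->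
  {ae m1, forall x, (N2 m2 (fun y => F (x, y)) < +oo)%E}.
Proof.
move=> mF Foo.
have /(integrable_ae measurableT) : m1.-integrable setT (fun x => N2 m2 (fun y => F (x, y))).
  apply/integrableP; split; first exact: measurable_N2_pair1.
  by under eq_integral => x _ do rewrite gee0_abs ?N2_ge0//; rewrite -N2_prod1.
by apply: filterS => x /(_ I); rewrite ge0_fin_numE ?N2_ge0.
Qed.

(** The two parts are measurable by Tonelli, and so is their difference with its conventional value
    at [+oo - +oo]. Transforms are thus known to be measurable before it is known which sections are
    integrable. *)
Lemma emeasurable_integral1 (f : T1 * T2 -> \bar R) : measurable_fun setT f ->
  measurable_fun setT (fun x => \int[m2]_y f (x, y))%E.
Proof.
move=> mf; rewrite (_ : (fun x => _) =
    (fun x => \int[m2]_y (f^\+ (x, y)) - \int[m2]_y (f^\- (x, y)))%E); last first.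
  apply/funext => x; rewrite [LHS]integralE.
  under eq_integral do rewrite funepos_comp/=.
  by under [X in (_ - X)%E = _]eq_integral do rewrite funeneg_comp/=.
apply: emeasurable_funB; apply: measurable_fun_fubini_tonelli_F => //.
  exact: measurable_funepos.
exact: measurable_funeneg.
Qed.

Lemma measurable_Rintegral1 (f : T1 * T2 -> R) : measurable_fun setT f ->
  measurable_fun setT (fun x => \int[m2]_y f (x, y)).
Proof.
move=> mf; apply: (measurableT_comp (fine_measurable measurableT)).
by apply: (@emeasurable_integral1 (EFin \o f)); exact/measurable_EFinP.
Qed.

Lemma cmeasurable_cintegral1 F : cmeasurable F ->
  cmeasurable (fun x => cintegral m2 (fun y => F (x, y))).
Proof.
move=> [F1 F2]; split; first exact: measurable_Rintegral1 F1.
exact: measurable_Rintegral1 F2.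
Qed.

(** An integrable function is finite almost everywhere, so the [fine] hidden in [Rintegral] changes
    nothing when integrals are iterated. *)
Lemma integrable_fine d (T : measurableType d) (m : {measure set T -> \bar R})
    (f : T -> \bar R) : m.-integrable setT f ->
  m.-integrable setT (EFin \o (fine \o f)) /\
  (\int[m]_x (fine (f x))%:E = \int[m]_x f x)%E.
Proof.
move=> fi.
have mf : measurable_fun setT f by case/integrableP : fi.
have mR : measurable_fun setT (EFin \o (fine \o f)).
  exact/measurable_EFinP/(measurableT_comp (fine_measurable measurableT)).
split.
  apply: (le_integrable measurableT mR _ fi) => x _ /=.
  by case: (f x) => [r| |] //=; rewrite normr0 ?leey ?leNye.
apply: ae_eq_integral => //; have := integrable_ae measurableT fi.
by apply: filterS => x /(_ I) h _; rewrite /= fineK.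
Qed.

Lemma RFubini1 (f : T1 * T2 -> R) : (sfprod m1 m2).-integrable setT (EFin \o f) ->
  m1.-integrable setT (EFin \o (fun x => \int[m2]_y f (x, y))) /\
  \int[sfprod m1 m2]_z f z = \int[m1]_x \int[m2]_y f (x, y).
Proof.
move=> fi; have [i1 i2] := integrable_fine (integrable_fubini_F fi).
split; first exact: i1.
by rewrite {1 2}/Rintegral -(integral12_prod_meas1 fi) -i2.
Qed.

Lemma RFubini2 (f : T1 * T2 -> R) : (sfprod m1 m2).-integrable setT (EFin \o f) ->
  m2.-integrable setT (EFin \o (fun y => \int[m1]_x f (x, y))) /\
  \int[sfprod m1 m2]_z f z = \int[m2]_y \int[m1]_x f (x, y).
Proof.
move=> fi.
have mf : measurable_fun setT (EFin \o f) by case/integrableP : fi.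
(* Exchanging the factors reduces this order of integration to the previous one. *)
have mf' : measurable_fun setT (fun z : T2 * T1 => (f (z.2, z.1))%:E).
  by apply: (measurableT_comp mf); exact: measurable_fun_pair.
have fi' : (sfprod m2 m1).-integrable setT (fun z : T2 * T1 => (f (z.2, z.1))%:E).
  by apply/integrable12ltyP => //; exact: ((integrable21ltyP _ _ mf).1 fi).
have [i1 i2] := integrable_fine (integrable_fubini_F fi').
split; first exact: i1.
by rewrite {1 2}/Rintegral -(integral21_prod_meas1 fi) -i2.
Qed.

Lemma cintegrable_cintegral1 F : cintegrable (sfprod m1 m2) F ->
  cintegrable m1 (fun x => cintegral m2 (fun y => F (x, y))).
Proof. by move=> [/RFubini1[F1 _] /RFubini1[F2 _]]; split. Qed.

Lemma cintegrable_cintegral2 F : cintegrable (sfprod m1 m2) F ->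
  cintegrable m2 (fun y => cintegral m1 (fun x => F (x, y))).
Proof. by move=> [/RFubini2[F1 _] /RFubini2[F2 _]]; split. Qed.

Lemma cFubini1 F : cintegrable (sfprod m1 m2) F ->
  cintegral (sfprod m1 m2) F = cintegral m1 (fun x => cintegral m2 (fun y => F (x, y))).
Proof.
move=> [/RFubini1[_ F1] /RFubini1[_ F2]]; apply: complexP => /=; first exact: F1.
exact: F2.
Qed.

Lemma cFubini2 F : cintegrable (sfprod m1 m2) F ->
  cintegral (sfprod m1 m2) F = cintegral m2 (fun y => cintegral m1 (fun x => F (x, y))).
Proof.
move=> [/RFubini2[_ F1] /RFubini2[_ F2]]; apply: complexP => /=; first exact: F1.
exact: F2.
Qed.

Lemma ae_cintegrable1 F : cintegrable (sfprod m1 m2) F ->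
  {ae m1, forall x, cintegrable m2 (fun y => F (x, y))}.
Proof.
move=> [/ae_integrable1 F1 /ae_integrable1 F2].
by apply: filterS2 F1 F2 => x h1 h2; split.
Qed.

Lemma cintegrable_prodP F : cmeasurable F ->
  (\int[m1]_x \int[m2]_y (normc (F (x, y)))%:E < +oo)%E ->
  cintegrable (sfprod m1 m2) F.
Proof.
move=> mF Foo; apply/cintegrableP; split => //.
rewrite /sfprod (fubini_tonelli1 (fun z => (normc (F z))%:E))//.
  exact/measurable_EFinP/measurable_normc.
by move=> z; rewrite lee_fin normc_ge0.
Qed.

Lemma cintegrable_tensor (a : T1 -> R[i]) (b : T2 -> R[i]) :
  cintegrable m1 a -> cintegrable m2 b ->
  cintegrable (sfprod m1 m2) (fun z => a z.1 * b z.2).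
Proof.
move=> /cintegrableP[ma ai] /cintegrableP[mb bi].
apply: cintegrable_prodP.
  by apply: cmeasurableM; [exact: (cmeasurable_comp measurable_fst)|
    exact: (cmeasurable_comp measurable_snd)].
under eq_integral => x _.
  under eq_integral => y _ do rewrite /= ComplexField.Normc.normcM EFinM.
  rewrite ge0_integralZl_EFin ?normc_ge0//; last 2 first.
    by move=> y _; rewrite lee_fin normc_ge0.
    exact/measurable_EFinP/measurable_normc.
  over.
have b0 : (0 <= \int[m2]_y (normc (b y))%:E)%E.
  by apply: integral_ge0 => y _; rewrite lee_fin normc_ge0.
rewrite ge0_integralZr//; last 2 first.
  exact/measurable_EFinP/measurable_normc.
  by move=> x _; rewrite lee_fin normc_ge0.
have a0 : (0 <= \int[m1]_x (normc (a x))%:E)%E.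
  by apply: integral_ge0 => x _; rewrite lee_fin normc_ge0.
by rewrite lte_mul_pinfty// ge0_fin_numE.
Qed.

End Product.

(** * Change of variables with a constant Jacobian *)

Section Pushforward.
Context d d' (T : measurableType d) (T' : measurableType d') {R : realType}.
Context (mu : {measure set T -> \bar R}) (nu : {measure set T' -> \bar R}).
Context (phi : T -> T') (c : R).
Hypothesis mphi : measurable_fun setT phi.
Hypothesis c0 : 0 <= c.
Hypothesis phiE : forall f : T' -> \bar R, measurable_fun setT f ->
  (forall x, 0 <= f x)%E ->
  (\int[mu]_x f (phi x) = c%:E * \int[nu]_y f y)%E.

Lemma N2_pushforward (f : T' -> R[i]) : cmeasurable f ->
  N2 mu (fun x => f (phi x)) = (c%:E * N2 nu f)%E.
Proof.
move=> mf; rewrite /N2 (phiE (f := fun y => (sqn (f y))%:E))//.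
  exact/measurable_EFinP/measurable_sqn.
by move=> x; rewrite lee_fin sqn_ge0.
Qed.

(** The assumption [phiE] speaks of nonnegative functions; it is applied to the positive and
    negative parts, whose integrals are finite and may be subtracted. *)
Lemma integrable_pushforwardE (f : T' -> \bar R) : nu.-integrable setT f ->
  mu.-integrable setT (fun x => f (phi x)) /\
  (\int[mu]_x f (phi x) = c%:E * \int[nu]_y f y)%E.
Proof.
move=> fi; have mf : measurable_fun setT f by case/integrableP : fi.
split.
  apply/integrableP; split; first exact: (measurableT_comp mf).
  rewrite (phiE (f := fun y => `|f y|%E))//; last exact: measurableT_comp.
  by case/integrableP : fi => _ fi; rewrite lte_mul_pinfty.
rewrite integralE [in RHS]integralE.
have -> : ((fun x => f (phi x))^\+ = fun x => f^\+ (phi x))%E.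
  by rewrite -[fun x => f (phi x)]/(f \o phi) funepos_comp.
have -> : ((fun x => f (phi x))^\- = fun x => f^\- (phi x))%E.
  by rewrite -[fun x => f (phi x)]/(f \o phi) funeneg_comp.
rewrite !phiE//; [|exact: measurable_funeneg|exact: measurable_funepos].
rewrite [RHS]muleBr//; apply: fin_num_adde_defl; rewrite fin_numN.
exact: integrable_neg_fin_num.
Qed.

Lemma cintegrable_pushforward (f : T' -> R[i]) : cintegrable nu f ->
  cintegrable mu (fun x => f (phi x)).
Proof.
by move=> [/integrable_pushforwardE[f1 _] /integrable_pushforwardE[f2 _]]; split.
Qed.

Lemma cintegral_pushforward (f : T' -> R[i]) : cintegrable nu f ->
  cintegral mu (fun x => f (phi x)) = real_complex R c * cintegral nu f.
Proof.
move=> [f1 f2].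
have [_ /(congr1 fine) e1] := integrable_pushforwardE f1.
have [_ /(congr1 fine) e2] := integrable_pushforwardE f2.
apply: complexP; rewrite !complexE /= ?mul0r ?subr0 ?addr0.
  by rewrite [LHS]e1 fineM// integrable_fin_num.
by rewrite [LHS]e2 fineM// integrable_fin_num.
Qed.

End Pushforward.

Lemma ae_eq_cintegral d (T : measurableType d) {R : realType}
    (mu : {measure set T -> \bar R}) (f g : T -> R[i]) :
  cmeasurable f -> cmeasurable g -> {ae mu, forall x, f x = g x} ->
  cintegral mu f = cintegral mu g.
Proof.
move=> [f1 f2] [g1 g2] fg; apply: complexP => /=; rewrite /Rintegral; congr fine;
  apply: ae_eq_integral => //; try exact/measurable_EFinP;
  by apply: filterS fg => x /= -> _.
Qed.

(** * The Plancherel identity for an abstract phase *)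

Section Plancherel.
Context {R : realType} d d' (X : measurableType d) (Xi : measurableType d').
Context (m : {sigma_finite_measure set X -> \bar R}).
Context (n : {sigma_finite_measure set Xi -> \bar R}).
Implicit Types (theta : Xi -> X -> R) (h : X -> R[i]).

(** The phase [theta] is arbitrary, so that both signs of the kernel, sums of phases on products and
    exchanged frequencies are covered at once. *)
Definition ft theta h (w : Xi) : R[i] :=
  cintegral m (fun t => expi (theta w t) * h t).

Definition plancherel theta : Prop := forall h, cintegrable m h ->
  (N2 m h < +oo)%E -> N2 n (ft theta h) = N2 m h.

(** An infinite right-hand side makes the bound trivial. This form serves sections that are
    integrable for every parameter but known to be square integrable only for almost every one. *)
Lemma plancherel_le theta h : plancherel theta -> cintegrable m h ->
  (N2 n (ft theta h) <= N2 m h)%E.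
Proof.
move=> pl hi; have [h2|] := ltP (N2 m h) +oo%E; first by rewrite pl.
by rewrite leye_eq => /eqP ->; rewrite leey.
Qed.

Lemma cmeasurable_ft theta h :
  measurable_fun setT (fun p : Xi * X => theta p.1 p.2) -> cmeasurable h ->
  cmeasurable (ft theta h).
Proof.
move=> mt mh; rewrite /ft.
apply: (@cmeasurable_cintegral1 _ _ _ _ _ m
  (fun p => expi (theta p.1 p.2) * h p.2)).
apply: cmeasurableM; first exact: cmeasurable_expi.
exact: cmeasurable_comp mh.
Qed.

Lemma ftN theta h w : measurable_fun setT (theta w) -> cintegrable m h ->
  ft (fun w t => - theta w t) h w = conjc (ft theta (fun t => conjc (h t)) w).
Proof.
move=> mt hi; rewrite /ft -cintegralJ.
  congr cintegral; apply/funext => t; rewrite -conj_expi.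
  by apply: complexP; rewrite !complexE; ring.
by apply: cintegrable_expiM => //; exact: cintegrableJ.
Qed.

(** Conjugation exchanges the two signs of the phase and preserves [sqn]. *)
Lemma plancherelN theta : (forall w, measurable_fun setT (theta w)) ->
  plancherel theta -> plancherel (fun w t => - theta w t).
Proof.
move=> mt pl h hi h2.
have E : N2 m (fun x => conjc (h x)) = N2 m h.
  by apply: eq_integral => x _; rewrite sqnJ.
rewrite -E -(pl _ (cintegrableJ hi)) ?E//.
by apply: eq_integral => w _; rewrite ftN// sqnJ.
Qed.

End Plancherel.

(** * Plancherel for a sum of phases on a product space *)

Section PlancherelProduct.
Context {R : realType}.
Context d1 d1' (X1 : measurableType d1) (Xi1 : measurableType d1').
Context d2 d2' (X2 : measurableType d2) (Xi2 : measurableType d2').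
Context (m1 : {sigma_finite_measure set X1 -> \bar R}).
Context (n1 : {sigma_finite_measure set Xi1 -> \bar R}).
Context (m2 : {sigma_finite_measure set X2 -> \bar R}).
Context (n2 : {sigma_finite_measure set Xi2 -> \bar R}).
Context (theta1 : Xi1 -> X1 -> R) (theta2 : Xi2 -> X2 -> R).
Hypothesis mtheta1 : measurable_fun setT (fun p : Xi1 * X1 => theta1 p.1 p.2).
Hypothesis mtheta2 : measurable_fun setT (fun p : Xi2 * X2 => theta2 p.1 p.2).
Hypothesis pl1 : plancherel m1 n1 theta1.
Hypothesis pl2 : plancherel m2 n2 theta2.

Let theta (w : Xi1 * Xi2) (t : X1 * X2) := theta1 w.1 t.1 + theta2 w.2 t.2.

Let mtheta1w w : measurable_fun setT (theta1 w).
Proof. exact: (measurableT_comp mtheta1 (pair1_measurable w)). Qed.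

Let mtheta2w w : measurable_fun setT (theta2 w).
Proof. exact: (measurableT_comp mtheta2 (pair1_measurable w)). Qed.

Lemma measurable_theta_prod :
  measurable_fun setT (fun p : (Xi1 * Xi2) * (X1 * X2) => theta p.1 p.2).
Proof.
apply: measurable_funD.
  apply: (measurableT_comp mtheta1
    (g := fun p : (Xi1 * Xi2) * (X1 * X2) => (p.1.1, p.2.1))).
  by apply: measurable_fun_pair; apply: measurableT_comp => //; exact: measurable_fst.
apply: (measurableT_comp mtheta2
  (g := fun p : (Xi1 * Xi2) * (X1 * X2) => (p.1.2, p.2.2))).
by apply: measurable_fun_pair; apply: measurableT_comp => //; exact: measurable_snd.
Qed.

Section OneFunction.
Context (h : X1 * X2 -> R[i]).
Hypothesis hi : cintegrable (sfprod m1 m2) h.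
Let mh : cmeasurable h := cintegrable_measurable hi.

(** The transform in the second variable alone, as a function of the new frequency and the remaining
    position. Plancherel in one variable compares it with [h], Plancherel in the other with the full
    transform. *)
Let G (p : Xi2 * X1) : R[i] := ft m2 theta2 (fun t2 => h (p.2, t2)) p.1.

Let mG : cmeasurable G.
Proof.
rewrite /G /ft.
apply: (@cmeasurable_cintegral1 _ _ _ _ _ m2
  (fun p : (Xi2 * X1) * X2 => expi (theta2 p.1.1 p.2) * h (p.1.2, p.2))).
apply: cmeasurableM.
  apply: cmeasurable_expi.
  apply: (measurableT_comp mtheta2 (g := fun p : (Xi2 * X1) * X2 => (p.1.1, p.2))).
  by apply: measurable_fun_pair => //; apply: measurableT_comp => //; exact: measurable_fst.
apply: (cmeasurable_comp (f := h) (phi := fun p : (Xi2 * X1) * X2 => (p.1.2, p.2))) => //.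
by apply: measurable_fun_pair => //; apply: measurableT_comp => //; exact: measurable_fst.
Qed.

Let hi2 w2 : cintegrable (sfprod m1 m2) (fun p => expi (theta2 w2 p.2) * h p).
Proof.
by apply: cintegrable_expiM => //; exact: (measurableT_comp (mtheta2w w2)).
Qed.

Lemma cintegrable_ft2 w2 :
  cintegrable m1 (fun t1 => ft m2 theta2 (fun t2 => h (t1, t2)) w2).
Proof. exact: (cintegrable_cintegral1 (hi2 w2)). Qed.

Lemma ft_prod w : ft (sfprod m1 m2) theta h w =
  ft m1 theta1 (fun t1 => ft m2 theta2 (fun t2 => h (t1, t2)) w.2) w.1.
Proof.
rewrite {1}/ft cFubini1; last first.
  apply: cintegrable_expiM => //.
  exact: (measurableT_comp measurable_theta_prod (pair1_measurable w)).
(* Pulling the phase out of the inner integral is only legitimate almost everywhere: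
   [Rintegral] has junk values on sections that are not integrable. *)
apply: (@ae_eq_cintegral _ _ _ m1
   (fun t1 => cintegral m2 (fun t2 => expi (theta w (t1, t2)) * h (t1, t2)))).
- apply: (@cmeasurable_cintegral1 _ _ _ _ _ m2
    (fun p => expi (theta w p) * h p)).
  apply: cmeasurableM => //; apply: cmeasurable_expi.
  exact: (measurableT_comp measurable_theta_prod (pair1_measurable w)).
- apply: cmeasurableM; first exact: cmeasurable_expi.
  exact: (cintegrable_measurable (cintegrable_ft2 w.2)).
- have := ae_cintegrable1 (hi2 w.2); apply: filterS => t1 it1 /=.
  rewrite /ft -cintegralZ//; congr cintegral; apply/funext => t2.
  by rewrite /theta expiD mulrA.
Qed.

Let N2G : (N2 (sfprod m1 m2) h < +oo)%E -> N2 (sfprod n2 m1) G = N2 (sfprod m1 m2) h.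
Proof.
move=> h2; rewrite N2_prod2// N2_prod1//.
apply: ge0_ae_eq_integral => //; try by move=> x _; exact: N2_ge0.
- exact: measurable_N2_pair2.
- exact: measurable_N2_pair1.
- apply: filterS2 (ae_cintegrable1 hi) (ae_N2_lty1 mh h2) => t1 i1 f1 _.
  by rewrite -(pl2 i1 f1).
Qed.

Lemma plancherel_prod_aux : (N2 (sfprod m1 m2) h < +oo)%E ->
  N2 (sfprod n1 n2) (ft (sfprod m1 m2) theta h) = N2 (sfprod m1 m2) h.
Proof.
move=> h2; rewrite -N2G// N2_prod2; last first.
  exact: cmeasurable_ft measurable_theta_prod mh.
rewrite [RHS]N2_prod1//; apply: ge0_ae_eq_integral => //; try by move=> x _; exact: N2_ge0.
- apply: measurable_N2_pair2; exact: cmeasurable_ft measurable_theta_prod mh.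
- exact: measurable_N2_pair1.
(* Finiteness for [G] makes almost every section in [t1] square integrable, as [pl1] requires. *)
- have G2 : (N2 (sfprod n2 m1) G < +oo)%E by rewrite N2G.
  have := ae_N2_lty1 mG G2; apply: filterS => w2 f2 _.
  rewrite -(pl1 (cintegrable_ft2 w2) f2); apply: eq_integral => w1 _.
  by rewrite ft_prod.
Qed.

End OneFunction.

Lemma plancherel_prod : plancherel (sfprod m1 m2) (sfprod n1 n2) theta.
Proof. by move=> h hi h2; exact: plancherel_prod_aux. Qed.

(** The symplectic form makes the second frequency dual to the first position and conversely;
    Tonelli allows the exchange. *)
Lemma plancherel_prod_swap : plancherel (sfprod m1 m2) (sfprod n2 n1)
  (fun w t => theta1 w.2 t.1 + theta2 w.1 t.2).
Proof.
move=> h hi h2; rewrite -(plancherel_prod hi h2).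
have mF := cmeasurable_ft (sfprod m1 m2) measurable_theta_prod (cintegrable_measurable hi).
rewrite N2_prod2.
  by rewrite N2_prod1.
apply: (cmeasurable_comp (f := ft (sfprod m1 m2) theta h)
  (phi := fun w : Xi2 * Xi1 => (w.2, w.1))) => //.
exact: measurable_fun_pair.
Qed.

End PlancherelProduct.

(** * Transport of Plancherel along a measure-preserving map *)

Section PlancherelPushforward.
Context {R : realType}.
Context d d' (X : measurableType d) (X' : measurableType d').
Context (m : {sigma_finite_measure set X -> \bar R}).
Context (m' : {sigma_finite_measure set X' -> \bar R}).
Context (phi : X' -> X) (theta : X -> X -> R).
Hypothesis mtheta : measurable_fun setT (fun p : X * X => theta p.1 p.2).
Hypothesis mphi : measurable_fun setT phi.
Hypothesis phiE : forall f : X -> \bar R, measurable_fun setT f ->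
  (forall x, 0 <= f x)%E -> (\int[m']_x f (phi x) = 1%:E * \int[m]_y f y)%E.

Lemma plancherel_pushforward :
  plancherel m' m' (fun w t => theta (phi w) (phi t)) -> plancherel m m theta.
Proof.
move=> pl h hi h2; have mh := cintegrable_measurable hi.
have E f : cmeasurable f -> N2 m' (fun x => f (phi x)) = N2 m f.
  by move=> mf; rewrite (N2_pushforward phiE mf) mul1e.
have hi' := cintegrable_pushforward mphi ler01 phiE hi.
have h2' : (N2 m' (fun x => h (phi x)) < +oo)%E by rewrite E.
rewrite -(E h)// -(pl _ hi' h2') -E; last exact: cmeasurable_ft.
apply: eq_integral => w _; congr (sqn _)%:E; rewrite /ft.
rewrite -[LHS]mul1r -(cintegral_pushforward mphi ler01 phiE)//.
apply: cintegrable_expiM => //.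
exact: (measurableT_comp mtheta (pair1_measurable (phi w))).
Qed.

End PlancherelPushforward.

(** * Lebesgue measure on R^d *)

Section Affine1.
Context {R : realType}.
Local Notation leb := (@lebesgue_measure R).

Lemma measurable_affine (a c : R) :
  measurable_fun setT (fun x : measurableTypeR R => c + a * x : measurableTypeR R).
Proof. by apply: measurable_funD => //; exact: mulrl_measurable. Qed.

(** The image of Lebesgue measure under [x |-> c + a x], multiplied by [a], has the right value on
    half-open intervals, hence is Lebesgue measure by uniqueness. *)
Lemma lebesgue_affine_pos (a c : R) (f : R -> \bar R) : 0 < a ->
  measurable_fun setT f -> (forall x, 0 <= f x)%E ->
  (\int[leb]_x f (c + a * x)%R = a^-1%:E * \int[leb]_x f x)%E.
Proof.
move=> a0 mf f0.
pose phi (x : measurableTypeR R) : measurableTypeR R := c + a * x.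
have mphi : measurable_fun setT phi := measurable_affine a c.
rewrite -(ge0_integral_pushforward mphi leb measurableT mf); last by move=> x _.
have a0' : 0 <= a := ltW a0.
pose k : {nonneg R} := NngNum a0'.
have mE A : measurable A -> leb A = (mscale k (pushforward leb phi)) A.
  apply: lebesgue_measure_unique => _ [[u v]] _ <-.
  have Ephi : phi @^-1` `]u, v]%classic = `](u - c) / a, (v - c) / a]%classic.
    apply/seteqP; split=> x /=; rewrite !in_itv /= /phi.
      by rewrite ltr_pdivrMr// ler_pdivlMr// ltrBlDl lerBrDl mulrC.
    by rewrite ltr_pdivrMr// ler_pdivlMr// ltrBlDl lerBrDl mulrC.
  rewrite -[RHS]/(a%:E * leb (phi @^-1` `]u, v]%classic))%E Ephi.
  rewrite !lebesgue_measure_itv /= !lte_fin ltr_pM2r ?invr_gt0// ltrD2r.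
  case: ifPn => uv; last by rewrite mule0.
  by rewrite -!EFinD -EFinM; congr EFin; field; rewrite gt_eqF.
rewrite [in RHS](eq_measure_integral (mscale k (pushforward leb phi))); last first.
  by move=> A mA _; exact: mE.
by rewrite ge0_integral_mscale//= muleA -EFinM mulVf ?gt_eqF// mul1e.
Qed.

Lemma lebesgue_opp (f : R -> \bar R) :
  measurable_fun setT f -> (forall x, 0 <= f x)%E ->
  (\int[leb]_x f (- x)%R = \int[leb]_x f x)%E.
Proof.
move=> mf f0.
have mphi : measurable_fun setT (-%R : measurableTypeR R -> measurableTypeR R).
  exact: oppr_measurable.
rewrite -(ge0_integral_pushforward mphi leb measurableT mf); last by move=> x _.
by apply: eq_measure_integral => //= A mA _; exact: lebesgue_measureN.
Qed.

Lemma lebesgue_affine (a c : R) (f : R -> \bar R) : a != 0 ->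
  measurable_fun setT f -> (forall x, 0 <= f x)%E ->
  (\int[leb]_x f (c + a * x)%R = `|a|^-1%:E * \int[leb]_x f x)%E.
Proof.
move=> a0 mf f0; have [a_gt0|a_lt0|/eqP] := ltgtP a 0; last by rewrite (negPf a0).
  have na0 : 0 < - a by rewrite oppr_gt0.
  rewrite ltr0_norm// -(lebesgue_affine_pos c na0 mf f0) -lebesgue_opp.
  - by apply: eq_integral => x _; rewrite mulrN mulNr.
  - exact: (measurableT_comp mf (measurable_affine a c)).
  - by [].
by rewrite gtr0_norm//; exact: lebesgue_affine_pos.
Qed.

End Affine1.

(** * Affine maps of R^d, and Plancherel from dimension 1 to dimension d *)

Section Vectors.
Context {R : realType}.
Local Notation leb := (@lebesgue_measure R).

Section Measurability.
Context d (T : measurableType d) (n : nat).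
Implicit Types f g : T -> Rvec R n.

Lemma measurable_coord f i : measurable_fun setT f ->
  measurable_fun setT (fun x => Defs.coord (f x) i : R).
Proof. by move=> mf; exact: (measurableT_comp (measurable_tnth i) mf). Qed.

Lemma measurable_mkvec (F : T -> 'I_n -> R) :
  (forall i, measurable_fun setT (fun x => F x i)) ->
  measurable_fun setT (fun x => mkvec (F x)).
Proof.
move=> mF; apply/measurable_fun_tnthP => i.
rewrite (_ : _ \o _ = fun x => F x i); first exact: mF.
by apply/funext => x /=; rewrite tnth_mktuple.
Qed.

Lemma measurable_vdot f g : measurable_fun setT f -> measurable_fun setT g ->
  measurable_fun setT (fun x => vdot (f x) (g x)).
Proof.
move=> mf mg; apply: measurable_sum => i.
by apply: measurable_funM; exact: measurable_coord.
Qed.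

Lemma measurable_vsub f g : measurable_fun setT f -> measurable_fun setT g ->
  measurable_fun setT (fun x => vsub (f x) (g x)).
Proof.
move=> mf mg; apply: measurable_mkvec => i.
by apply: measurable_funB; exact: measurable_coord.
Qed.

Lemma measurable_vscale (a : R) f : measurable_fun setT f ->
  measurable_fun setT (fun x => vscale a (f x)).
Proof.
move=> mf; apply: measurable_mkvec => i.
by apply: measurable_funM => //; exact: measurable_coord.
Qed.

Lemma measurable_vopp f : measurable_fun setT f ->
  measurable_fun setT (fun x => vopp (f x)).
Proof.
by move=> mf; apply: measurable_mkvec => i; apply: measurable_funN; exact: measurable_coord.
Qed.

End Measurability.

Lemma coord_mkvec n (F : 'I_n -> R) i : Defs.coord (mkvec F) i = F i.
Proof. by rewrite /Defs.coord /mkvec tnth_mktuple. Qed.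

Lemma coordP n (x y : Rvec R n) : (forall i, Defs.coord x i = Defs.coord y i) -> x = y.
Proof. exact: eq_from_tnth. Qed.

(** Translations, reflections and [x |-> x/2 - p] all have this form, so a single change of
    variables serves them. *)
Definition vaff n (a : R) (c x : Rvec R n) : Rvec R n :=
  mkvec (fun i => Defs.coord c i + a * Defs.coord x i).

Lemma measurable_vaff n a (c : Rvec R n) : measurable_fun setT (vaff a c).
Proof.
apply: measurable_mkvec => i; apply: measurable_funD => //.
by apply: measurable_funM => //; exact: measurable_tnth.
Qed.

Lemma vcons_eta n (c : Rvec R n.+1) : exists p, c = vcons p.
Proof.
by exists (thead c, [tuple of behead c]); rewrite /vcons /= [LHS]tuple_eta.
Qed.

Lemma vaff_vcons n a (c x : measurableTypeR R * Rvec R n) :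
  vaff a (vcons c) (vcons x) =
  vcons ((c.1 + a * x.1 : measurableTypeR R), vaff a c.2 x.2).
Proof.
apply: coordP => i; rewrite coord_mkvec /Defs.coord.
have [->|[j ->]] : i = ord0 \/ exists j, i = lift ord0 j.
  by case: (unliftP ord0 i) => [j ->|->]; [right; exists j|left].
  by [].
by rewrite !tnthS tnth_mktuple.
Qed.

Lemma vdot_vcons n (w x : measurableTypeR R * Rvec R n) :
  vdot (vcons w) (vcons x) = w.1 * x.1 + vdot w.2 x.2.
Proof.
rewrite /vdot big_ord_recl; congr (_ + _).
by apply: eq_bigr => i _; rewrite /Defs.coord !tnthS.
Qed.

(** The factor [1%:E] gives the identity the shape of the change-of-variables hypothesis [phiE]. *)
Lemma lebesgue_stepE n (f : Rvec R n.+1 -> \bar R) : measurable_fun setT f ->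
  (forall x, 0 <= f x)%E ->
  (\int[sfprod leb (lebesgue_vec R n)]_x f (vcons x) =
   1%:E * \int[lebesgue_vec R n.+1]_y f y)%E.
Proof.
move=> mf f0; rewrite mul1e.
rewrite -(ge0_integral_pushforward (@measurable_vcons R n)
  (sfprod leb (lebesgue_vec R n)) measurableT mf)//.
Qed.

(** By Tonelli, the induction hypothesis treats the tail with the head fixed, and the substitution
    on the line then treats the head; each coordinate contributes a factor [|a|^-1]. *)
Lemma lebesgue_vec_affine n a (c : Rvec R n) (f : Rvec R n -> \bar R) : a != 0 ->
  measurable_fun setT f -> (forall x, 0 <= f x)%E ->
  (\int[lebesgue_vec R n]_x f (vaff a c x) =
   (`|a| ^- n)%:E * \int[lebesgue_vec R n]_x f x)%E.
Proof.
move=> a0; elim: n c f => [|n IH] c f mf f0.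
  rewrite expr0 invr1 mul1e; apply: eq_integral => x _; congr f.
  by rewrite [LHS]tuple0 [RHS]tuple0.
have [p ->] := vcons_eta c.
have mfa := measurableT_comp mf (measurable_vaff a (vcons p)).
have mfc : measurable_fun setT (fun x => f (vcons x)).
  exact: measurableT_comp mf (@measurable_vcons R n).
have mfac : measurable_fun setT (fun x => f (vaff a (vcons p) (vcons x))).
  exact: measurableT_comp mfa (@measurable_vcons R n).
have := lebesgue_stepE mfa (fun x => f0 _); have := lebesgue_stepE mf f0.
rewrite !mul1e => <- <-.
rewrite (fubini_tonelli1 (fun x => f (vcons x)))//.
rewrite (fubini_tonelli1 (fun x => f (vaff a (vcons p) (vcons x))))//.
pose J (x : measurableTypeR R) := (\int[lebesgue_vec R n]_y f (vcons (x, y)))%E.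
have mJ : measurable_fun setT J.
  exact: (measurable_fun_fubini_tonelli_F _ mfc (fun x => f0 (vcons x))).
have J0 x : (0 <= J x)%E by exact: integral_ge0.
transitivity (\int[leb]_x ((`|a| ^- n)%:E * J (p.1 + a * x)%R))%E.
  apply: eq_integral => x _; rewrite /fubini_F.
  under eq_integral => y _ do rewrite vaff_vcons /=.
  rewrite (IH p.2 (fun y => f (vcons ((p.1 + a * x : measurableTypeR R), y))))//.
  exact: (measurableT_comp mfc (pair1_measurable (p.1 + a * x))).
rewrite ge0_integralZl//; last first.
  exact: (measurableT_comp mJ (measurable_affine a p.1)).
rewrite (lebesgue_affine p.1 a0 mJ)//.
by rewrite muleA -EFinM exprSr invfM mulrC.
Qed.

Lemma plancherel_vec n :
  plancherel leb leb (fun w t : R => - (2 * pi * (w * t))) ->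
  plancherel (lebesgue_vec R n) (lebesgue_vec R n) (fun w t => - (2 * pi * vdot w t)).
Proof.
move=> pl1; elim: n => [|n IH].
  (* In dimension 0 the measure is a Dirac mass at the only point, and the transform multiplies [h]
     there by a number of modulus 1. *)
  move=> h hi h2; have mh := cintegrable_measurable hi.
  have E (f : Rvec R 0 -> \bar R) : measurable_fun setT f ->
      (\int[lebesgue_vec R 0]_x f x)%E = f [tuple].
    by move=> mf; rewrite [LHS]integral_dirac// diracT mul1e.
  have mt : measurable_fun setT (fun p : Rvec R 0 * Rvec R 0 => - (2 * pi * vdot p.1 p.2)).
    by apply: measurable_funN; apply: measurable_funM => //; exact: measurable_vdot.
  have mft := cmeasurable_ft (theta := fun w t : Rvec R 0 => - (2 * pi * vdot w t))
    (lebesgue_vec R 0) mt mh.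
  rewrite /N2 !E; try by apply/measurable_EFinP/measurable_sqn.
  have mF : cmeasurable (fun t => expi (- (2 * pi * vdot ([tuple] : Rvec R 0) t)) * h t).
    apply: cmeasurableM => //; apply: cmeasurable_expi.
    exact: measurableT_comp mt (pair1_measurable _).
  rewrite (_ : ft _ _ _ _ = expi (- (2 * pi * vdot ([tuple] : Rvec R 0) [tuple])) * h [tuple]).
    by rewrite sqnM sqn_expi mul1r.
  by apply: complexP; rewrite /= /Rintegral E//; apply/measurable_EFinP; apply mF.
have m1 : measurable_fun setT (fun p : measurableTypeR R * measurableTypeR R =>
    - (2 * pi * (p.1 * p.2)) : R).
  apply: measurable_funN; apply: measurable_funM => //; apply: measurable_funM => //.
have m2 k : measurable_fun setT (fun p : Rvec R k * Rvec R k => - (2 * pi * vdot p.1 p.2)).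
  apply: measurable_funN; apply: measurable_funM => //; apply: measurable_vdot => //.
apply: (plancherel_pushforward (m2 n.+1) (@measurable_vcons R n) (@lebesgue_stepE n)).
have := plancherel_prod m1 (m2 n) pl1 IH.
set u := (X in plancherel _ _ X); set v := (X in _ -> plancherel _ _ X).
suff -> : u = v by [].
apply/funext => w; apply/funext => t; rewrite /u /v vdot_vcons; ring.
Qed.

End Vectors.

(** * The Plancherel identity on the line *)

Section ExpDecay.
Context {R : realType}.
Local Notation leb := (@lebesgue_measure R).
Implicit Types e a x : R.

Definition expdecay e x : R := expR (- (e * `|x|)).

Lemma continuous_expdecay e : continuous (expdecay e).
Proof.
move=> x; apply: continuous_comp; last exact: continuous_expR.
by apply: cvgN; apply: cvgM; [exact: cvg_cst|exact: norm_continuous].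
Qed.

Lemma continuous_cosM a : continuous (fun x => cos (a * x)).
Proof.
move=> x; apply: (@continuous_comp _ _ _ ( *%R a) (@cos R)); [exact: mulrl_continuous|exact: continuous_cos].
Qed.

Lemma measurable_expdecay e : measurable_fun setT (expdecay e).
Proof. by apply: continuous_measurable_fun; exact: continuous_expdecay. Qed.

Lemma expdecay_primitive e a (F := fun x => - (expR (- (e * x)) *
    (e^-1 + (e * cos (a * x) - a * sin (a * x)) / (e ^+ 2 + a ^+ 2)))) x :
  0 < e -> is_derive x 1 F (expR (- (e * x)) * (1 + cos (a * x))).
Proof.
move=> e0; have ea0 : e ^+ 2 + a ^+ 2 != 0.
  by rewrite gt_eqF// ltr_wpDr ?sqr_ge0// exprn_gt0.
have e0' : e != 0 by rewrite gt_eqF.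
rewrite /F; apply: is_derive_eq; rewrite /GRing.scale /=.
by field; rewrite ea0 e0'.
Qed.

(** Adding 1 to the cosine makes the integrand nonnegative, so that the fundamental theorem for
    nonnegative functions on a half-line applies; the added exponential is subtracted again in
    [cintegral_expdecay]. *)
Lemma integral_expdecay_cos1 e a : 0 < e ->
  (\int[leb]_x (expdecay e x * (1 + cos (a * x)))%:E =
   (2 * (e^-1 + e / (e ^+ 2 + a ^+ 2)))%:E)%E.
Proof.
move=> e0; have ea0 : 0 < e ^+ 2 + a ^+ 2.
  by rewrite ltr_wpDr ?sqr_ge0// exprn_gt0.
have f0 x : 0 <= expdecay e x * (1 + cos (a * x)).
  by rewrite mulr_ge0 ?expR_ge0// -lerBlDl sub0r cos_geN1.
have cf : continuous (fun x => expdecay e x * (1 + cos (a * x))).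
  move=> x; apply: cvgM; first exact: continuous_expdecay.
  by apply: cvgD; [exact: cvg_cst|exact: continuous_cosM].
rewrite ge0_symfun_integralT//; last first.
  by move=> x /=; rewrite /expdecay normrN mulrN cosN.
rewrite (_ : [set x | _] = `[0, +oo[%classic); last first.
  by apply/seteqP; split => x/=; rewrite in_itv/= andbT.
have -> : (\int[leb]_(x in `[0%R, +oo[) (expdecay e x * (1 + cos (a * x)))%:E =
   \int[leb]_(x in `[0%R, +oo[) (expR (- (e * x)) * (1 + cos (a * x)))%:E)%E.
  apply: eq_integral => x; rewrite inE /= in_itv /= andbT => x0.
  by rewrite /expdecay ger0_norm.
pose F x := - (expR (- (e * x)) *
    (e^-1 + (e * cos (a * x) - a * sin (a * x)) / (e ^+ 2 + a ^+ 2))).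
have dF x := expdecay_primitive a x e0.
have cg : continuous (fun x => expR (- (e * x)) * (1 + cos (a * x))).
  move=> x; apply: cvgM.
    apply: (@continuous_comp _ _ _ (fun x => - (e * x)) (@expR R)).
      by apply: cvgN; exact: mulrl_continuous.
    exact: continuous_expR.
  by apply: cvgD; [exact: cvg_cst|exact: continuous_cosM].
have F0 : F x @[x --> +oo] --> 0.
  (* A bound for the bounded factor of [F], from [|cos| <= 1] and [|sin| <= 1]. *)
  pose C := e^-1 + (e + `|a|) / (e ^+ 2 + a ^+ 2).
  have Ex : expR (- (e * x)) @[x --> +oo] --> 0.
    apply: (@cvg_comp _ _ _ (fun x => e * x) (fun y => expR (- y))); last exact: cvgr_expR.
    exact: gt0_cvgMry.
  apply: (@squeeze_cvgr _ _ _ _ (fun x => - (C * expR (- (e * x))))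
                        (fun x => C * expR (- (e * x)))).
  - near=> x; rewrite -ler_norml /F normrN normrM ger0_norm ?expR_ge0// mulrC.
    rewrite ler_wpM2r ?expR_ge0// (le_trans (ler_normD _ _))//.
    rewrite (gtr0_norm (x := e^-1)) ?invr_gt0// /C lerD2l normrM normfV (gtr0_norm ea0).
    rewrite ler_pM2r ?invr_gt0// (le_trans (ler_normB _ _))// lerD// normrM.
      by rewrite (gtr0_norm e0) ler_piMr// ?(ltW e0)// ler_norml cos_geN1 cos_le1.
    by rewrite ler_piMr// ler_norml sin_geN1 sin_le1.
  - by rewrite -oppr0 -(mulr0 C); apply: cvgN; apply: cvgM => //; exact: cvg_cst.
  - by rewrite -(mulr0 C); apply: cvgM => //; exact: cvg_cst.
rewrite (ge0_continuous_FTC2y _ _ F0)/=.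
- rewrite -EFinB -EFinM; congr EFin; rewrite /F !mulr0 oppr0 expR0 cos0 sin0.
  by field; rewrite !gt_eqF.
- by move=> x x0; rewrite mulr_ge0 ?expR_ge0// -lerBlDl sub0r cos_geN1.
- by apply: continuous_subspaceT => x; exact: cg.
- by move=> x _; have [] := dF x.
- apply: cvg_at_right_filter; apply: differentiable_continuous.
  by apply/derivable1_diffP; have [] := dF 0.
- by move=> x _; rewrite derive1E; have [_ ->] := dF x.
Unshelve. all: by end_near.
Qed.

End ExpDecay.

(** * The Poisson kernel *)

Section PoissonKernel.
Context {R : realType}.
Local Notation leb := (@lebesgue_measure R).
Local Notation C x := (real_complex R x).
Implicit Types e a x : R.

Lemma expdecay_ge0 e x : 0 <= expdecay e x. Proof. exact: expR_ge0. Qed.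

Lemma integral_expdecay e : 0 < e -> (\int[leb]_x (expdecay e x)%:E = (2 / e)%:E)%E.
Proof.
(* At [a = 0] the factor [1 + cos] is the constant 2. *)
move=> e0; have := integral_expdecay_cos1 0 e0.
under eq_integral => x _ do rewrite mul0r cos0 mulrC EFinM.
rewrite ge0_integralZl_EFin//; last 2 first.
- by move=> x _; rewrite lee_fin expdecay_ge0.
- by apply/measurable_EFinP; exact: measurable_expdecay.
move=> /(congr1 (fun z => 2^-1%:E * z)%E); rewrite muleA -!EFinM => E.
have : (2^-1 * (1 + 1))%:E = 1%:E :> \bar R by congr EFin; field.
move=> H; rewrite H mul1e in E; rewrite E; congr EFin; field.
by rewrite gt_eqF.
Qed.

Lemma integrable_expdecay e : 0 < e -> leb.-integrable setT (EFin \o expdecay e).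
Proof.
move=> e0; apply/integrableP; split; first by apply/measurable_EFinP; exact: measurable_expdecay.
under eq_integral => x _ do rewrite /= ger0_norm ?expdecay_ge0//.
by rewrite integral_expdecay// ltry.
Qed.

Lemma cintegrable_real (f : R -> R) : leb.-integrable setT (EFin \o f) ->
  cintegrable leb (fun x => C (f x)).
Proof. by move=> fi; split => //; exact: integrable0. Qed.

Lemma integrable_lebN (f : R -> \bar R) : leb.-integrable setT f ->
  (\int[leb]_x f (- x)%R = \int[leb]_x f x)%E.
Proof.
move=> fi.
have h (g : R -> \bar R) : measurable_fun setT g -> (forall x, 0 <= g x)%E ->
    (\int[leb]_x g (- x)%R = 1%:E * \int[leb]_x g x)%E.
  by move=> mg g0; rewrite mul1e lebesgue_opp.
have mN : measurable_fun setT (-%R : measurableTypeR R -> measurableTypeR R).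
  exact: oppr_measurable.
by have [_ ->] := integrable_pushforwardE mN ler01 h fi; rewrite mul1e.
Qed.

Lemma cintegral_expdecay e a : 0 < e ->
  cintegral leb (fun x => C (expdecay e x) * expi (a * x)) =
  C (2 * e / (e ^+ 2 + a ^+ 2)).
Proof.
move=> e0; have ie := integrable_expdecay e0.
have [icos isin] : cintegrable leb (fun x => C (expdecay e x) * expi (a * x)).
  rewrite (_ : (fun x => _) = (fun x => expi (a * x) * C (expdecay e x))).
    apply: cintegrable_expiM; last exact: cintegrable_real.
    exact: mulrl_measurable.
  by apply/funext => x; rewrite mulrC.
apply: complexP => /=; last first.
  (* The imaginary part is the integral of an odd function, hence equal to its own opposite. *)
  set S := LHS.
  have : S = - S.
    rewrite {1}/S /Rintegral -integrable_lebN// -fineN; congr fine.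
    rewrite -integralN; last first.
      by apply: fin_num_adde_defl; rewrite fin_numN; exact: integrable_neg_fin_num.
    apply: eq_integral => x _; rewrite -EFinN; congr EFin.
    by rewrite ?complexE ?Im_expi ?Re_expi /expdecay normrN mulrN sinN; ring.
  by move=> SN; apply/eqP; rewrite -[_ == _](mulrn_eq0 _ 2) mulr2n {2}SN subrr.
have E : (fun x => complex.Re (C (expdecay e x) * expi (a * x))) =
    (fun x => expdecay e x * (1 + cos (a * x)) - expdecay e x).
  by apply/funext => x; rewrite !complexE /=; ring.
rewrite -[LHS]/(\int[leb]_x complex.Re (C (expdecay e x) * expi (a * x))).
rewrite E RintegralB//; last first.
  rewrite (_ : _ \o _ = (EFin \o (fun x => complex.Re (C (expdecay e x) * expi (a * x))%R)) \+
    (EFin \o expdecay e))%E; first exact: integrableD.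
  by apply/funext => x; rewrite /= ?complexE /= -EFinD; congr EFin; ring.
rewrite /Rintegral integral_expdecay_cos1// integral_expdecay//=.
by field; rewrite !gt_eqF// ltr_wpDr ?sqr_ge0// exprn_gt0.
Qed.

(** The Fourier transform of [expdecay e], an approximate identity as [e] tends to 0. *)
Definition poisson e x : R := 2 * e / (e ^+ 2 + (2 * pi * x) ^+ 2).

Lemma poisson_ge0 e x : 0 < e -> 0 <= poisson e x.
Proof.
by move=> e0; rewrite divr_ge0// ?mulr_ge0 ?(ltW e0)// addr_ge0// sqr_ge0.
Qed.

Lemma poissonN e x : poisson e (- x) = poisson e x.
Proof. by rewrite /poisson mulrN sqrrN. Qed.

Lemma measurable_poisson e : 0 < e -> measurable_fun setT (poisson e).
Proof.
move=> e0; apply: continuous_measurable_fun => x; apply: cvgM; first exact: cvg_cst.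
apply: cvgV; first by rewrite gt_eqF// ltr_wpDr ?sqr_ge0// exprn_gt0.
apply: cvgD; first exact: cvg_cst.
by apply: (@continuous_comp _ _ _ ( *%R (2 * pi)) (fun x => x ^+ 2));
  [exact: mulrl_continuous|exact: exprn_continuous].
Qed.

(** The Cauchy density. Every [poisson e] is a dilate of it by the factor [e / (2 pi)], so its mass
    and its limit behaviour can be read off a profile independent of [e]. *)
Definition cauchy x : R := pi^-1 * (oneDsqr x)^-1.

Lemma cauchy_ge0 x : 0 <= cauchy x.
Proof. by rewrite mulr_ge0 ?invr_ge0// ?pi_ge0. Qed.

Lemma measurable_cauchy : measurable_fun setT cauchy.
Proof.
apply: measurable_funM => //; apply: continuous_measurable_fun.
exact: continuous_oneDsqrV.
Qed.

Lemma integral_cauchy : (\int[leb]_x (cauchy x)%:E = 1)%E.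
Proof.
under eq_integral => x _ do rewrite EFinM.
rewrite ge0_integralZl_EFin ?invr_ge0 ?pi_ge0//; last first.
  apply/measurable_EFinP; apply: continuous_measurable_fun.
  exact: continuous_oneDsqrV.
rewrite ge0_symfun_integralT//; last 2 first.
- exact: continuous_oneDsqrV.
- by move=> x; rewrite /= /oneDsqr sqrrN.
rewrite (_ : [set x | _] = `[0, +oo[%classic); last first.
  by apply/seteqP; split => x/=; rewrite in_itv/= andbT.
rewrite integral0y_oneDsqr -!EFinM; congr EFin.
have : pi != 0 :> R by rewrite gt_eqF ?pi_gt0.
by move: (pi : R) => p p0; field.
Qed.

(** The argument keeps [s + ... - s] because this is what the affine substitution centred at [s]
    produces. *)
Lemma poisson_scale e s y : 0 < e ->
  poisson e (s + (e / (2 * pi)) * y - s) = 2 * pi / e * cauchy y.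
Proof.
move=> e0; have p0 : 0 < pi :> R := pi_gt0 R.
rewrite /poisson /cauchy /oneDsqr addrAC subrr add0r.
move: (pi : R) p0 => p p0.
rewrite [2 * p * _](_ : _ = e * y); last by field; rewrite gt_eqF.
have y0 : 1 + y ^+ 2 != 0 by rewrite gt_eqF// ltr_pwDl// sqr_ge0.
rewrite (_ : e ^+ 2 + (e * y) ^+ 2 = e ^+ 2 * (1 + y ^+ 2)); last by ring.
by field; rewrite y0 !gt_eqF.
Qed.

Lemma integral_poisson e s : 0 < e ->
  (\int[leb]_t (poisson e (t - s))%:E = 1)%E.
Proof.
move=> e0; have p0 : 0 < pi :> R := pi_gt0 R.
have a0 : 0 < e / (2 * pi) by rewrite divr_gt0// mulr_gt0.
have mf : measurable_fun setT (fun t : R => (poisson e (t - s))%:E).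
  apply/measurable_EFinP; apply: (measurableT_comp (measurable_poisson e0)).
  by apply: measurable_funB.
have f0 t : (0 <= (poisson e (t - s))%:E)%E by rewrite lee_fin poisson_ge0.
have := lebesgue_affine_pos s a0 mf f0.
under eq_integral => y _ do rewrite poisson_scale// EFinM.
rewrite ge0_integralZl_EFin ?integral_cauchy; last 4 first.
- by [].
- by move=> y _; rewrite lee_fin cauchy_ge0.
- by apply/measurable_EFinP; exact: measurable_cauchy.
- by rewrite ltW// divr_gt0// mulr_gt0.
rewrite invf_div mule1 => /(congr1 (fun z => (e / (2 * pi))%:E * z)%E).
rewrite muleA -!EFinM (_ : _ * _ = 1); first by rewrite mul1e => <-.
by move: (pi : R) p0 => p p0; field; rewrite !gt_eqF.
Qed.

End PoissonKernel.

Lemma cintegral_tensor d1 d2 (T1 : measurableType d1) (T2 : measurableType d2)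
    {R : realType} (m1 : {sigma_finite_measure set T1 -> \bar R})
    (m2 : {sigma_finite_measure set T2 -> \bar R}) (a : T1 -> R[i]) (b : T2 -> R[i]) :
  cintegrable m1 a -> cintegrable m2 b ->
  cintegral (sfprod m1 m2) (fun z => a z.1 * b z.2) = cintegral m1 a * cintegral m2 b.
Proof.
move=> ai bi; rewrite cFubini1; last exact: cintegrable_tensor.
rewrite [RHS]mulrC -cintegralZ//; congr cintegral; apply/funext => x /=.
by rewrite cintegralZ// mulrC.
Qed.

(** * The damped energy of a Fourier transform, and contraction *)

Section PoissonFormula.
Context {R : realType}.
Local Notation leb := (@lebesgue_measure R).
Local Notation T := (measurableTypeR R).
Local Notation C x := (real_complex R x).
Local Notation Re := complex.Re.

Definition theta1 (w t : T) : R := - (2 * pi * (w * t)).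

Lemma measurable_theta1 : measurable_fun setT (fun p : T * T => theta1 p.1 p.2).
Proof.
by apply: measurable_funN; apply: measurable_funM => //; apply: measurable_funM.
Qed.

Variable h : T -> R[i].
Hypothesis hi : cintegrable leb h.
Let mh : cmeasurable h := cintegrable_measurable hi.

Let k (p : T * T) : R[i] := h p.1 * conjc (h p.2).

Let ki : cintegrable (sfprod leb leb) k.
Proof. by apply: (cintegrable_tensor hi (b := fun x => conjc (h x))); exact: cintegrableJ. Qed.

Let mft : cmeasurable (ft leb theta1 h).
Proof. exact: cmeasurable_ft measurable_theta1 mh. Qed.

(** The squared modulus of the transform is a double integral over two copies of [h]. The damping
    makes the triple integrand [Phi] integrable, and integrating it in the frequency before the
    positions produces the Poisson kernel. *)
Lemma expdecay_ft (e : R) : 0 < e ->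
  (sfprod leb leb).-integrable setT
    (EFin \o (fun p => Re (k p) * poisson e (p.1 - p.2)))  /\
  (\int[leb]_w (expdecay e w * sqn (ft leb theta1 h w))%:E =
   (\int[sfprod leb leb]_p (Re (k p) * poisson e (p.1 - p.2)))%:E)%E.
Proof.
move=> e0.
pose Phi (q : (T * T) * T) : R[i] :=
  expi (- (2 * pi * (q.2 * (q.1.1 - q.1.2)))) * (k q.1 * C (expdecay e q.2)).
have Phii : cintegrable (sfprod (sfprod leb leb) leb) Phi.
  apply: cintegrable_expiM.
    apply: measurable_funN; apply: measurable_funM => //; apply: measurable_funM => //.
    apply: measurable_funB; first exact: (measurableT_comp measurable_fst measurable_fst).
    exact: (measurableT_comp measurable_snd measurable_fst).
  exact: (@cintegrable_tensor _ _ _ _ _ (sfprod leb leb) leb k (fun w => C (expdecay e w))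
    ki (cintegrable_real (integrable_expdecay e0))).
have inner1 p : cintegral leb (fun w => Phi (p, w)) = k p * C (poisson e (p.1 - p.2)).
  rewrite (_ : (fun w => _) = fun w => k p * (C (expdecay e w) * expi (- (2 * pi * (p.1 - p.2)) * w))).
    rewrite cintegralZ.
      by rewrite cintegral_expdecay// sqrrN.
    rewrite (_ : (fun x => _) = (fun x => expi (- (2 * pi * (p.1 - p.2)) * x) * C (expdecay e x))).
      apply: cintegrable_expiM; first exact: mulrl_measurable.
      exact/cintegrable_real/integrable_expdecay.
    by apply/funext => x; rewrite mulrC.
  apply/funext => w; rewrite /Phi /= (_ : - (2 * pi * (w * (p.1 - p.2))) = - (2 * pi * (p.1 - p.2)) * w).
    by rewrite mulrC mulrA.
  by ring.
have inner2 w : cintegral (sfprod leb leb) (fun p => Phi (p, w)) =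
    C (expdecay e w * sqn (ft leb theta1 h w)).
  rewrite (_ : (fun p => _) = fun p => C (expdecay e w) *
      ((expi (theta1 w p.1) * h p.1) * conjc (expi (theta1 w p.2) * h p.2))).
    have fi : cintegrable leb (fun t => expi (theta1 w t) * h t).
      apply: cintegrable_expiM => //.
      exact: measurableT_comp measurable_theta1 (pair1_measurable w).
    have fi' := cintegrableJ fi.
    rewrite cintegralZ; last exact: (cintegrable_tensor fi fi').
    rewrite (cintegral_tensor fi fi') cintegralJ//.
    by apply: complexP; rewrite /ft /sqn !complexE; ring.
  apply/funext => p; rewrite /Phi /k /=.
  rewrite (_ : - _ = theta1 w p.1 + - theta1 w p.2); last by rewrite /theta1; ring.
  rewrite expiD -conj_expi.
  by apply: complexP; rewrite !complexE; ring.
have [i1 _] := cintegrable_cintegral1 Phii.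
have [i2 _] := cintegrable_cintegral2 Phii.
have E1 : (fun p => Re (cintegral leb (fun w => Phi (p, w)))) =
    (fun p => Re (k p) * poisson e (p.1 - p.2)).
  by apply/funext => p; rewrite inner1 !complexE mulr0 subr0.
have E2 : (fun w => Re (cintegral (sfprod leb leb) (fun p => Phi (p, w)))) =
    (fun w => expdecay e w * sqn (ft leb theta1 h w)).
  by apply/funext => w; rewrite inner2.
rewrite E1 in i1; rewrite E2 in i2; split=> //.
have := cFubini1 Phii; rewrite (cFubini2 Phii) => /(congr1 (fun z => Re z)).
rewrite -[LHS]/(\int[leb]_w Re (cintegral (sfprod leb leb) (fun p => Phi (p, w)))).
rewrite -[RHS]/(\int[sfprod leb leb]_p Re (cintegral leb (fun w => Phi (p, w)))).
rewrite E1 E2 => <-; rewrite /Rintegral fineK//; exact: integrable_fin_num.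
Qed.

(** The kernel has mass one in each of its two variables, so each of the two terms contributes half
    of [N2 leb h]; the value may be infinite. *)
Lemma integral_sqn_poisson (e : R) : 0 < e ->
  (\int[sfprod leb leb]_p (2^-1 * (sqn (h p.1) + sqn (h p.2)) * poisson e (p.1 - p.2))%:E =
   N2 leb h)%E.
Proof.
move=> e0.
have mp : measurable_fun setT (fun p : T * T => poisson e (p.1 - p.2)).
  by apply: (measurableT_comp (measurable_poisson e0)); apply: measurable_funB.
have ms : measurable_fun setT (fun x => sqn (h x)) by exact: measurable_sqn.
have ms1 : measurable_fun setT (fun p : T * T => sqn (h p.1)).
  exact: measurableT_comp ms measurable_fst.
have ms2 : measurable_fun setT (fun p : T * T => sqn (h p.2)).
  exact: measurableT_comp ms measurable_snd.
have p0 x : 0 <= poisson e x by exact: poisson_ge0.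
have I1 : (\int[sfprod leb leb]_p (sqn (h p.1) * poisson e (p.1 - p.2))%:E = N2 leb h)%E.
  rewrite /sfprod (fubini_tonelli1 (fun p : T * T => (sqn (h p.1) * poisson e (p.1 - p.2))%:E))//.
  - apply: eq_integral => x _; rewrite /fubini_F /=.
    under eq_integral => y _ do rewrite EFinM -poissonN opprB.
    rewrite ge0_integralZl_EFin ?sqn_ge0//; last 2 first.
    + by move=> y _; rewrite lee_fin p0.
    + apply/measurable_EFinP; apply: (measurableT_comp (measurable_poisson e0)).
      exact: measurable_funB.
    by rewrite integral_poisson// mule1.
  - by apply/measurable_EFinP; exact: measurable_funM.
  - by move=> p; rewrite lee_fin mulr_ge0 ?sqn_ge0.
have I2 : (\int[sfprod leb leb]_p (sqn (h p.2) * poisson e (p.1 - p.2))%:E = N2 leb h)%E.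
  rewrite /sfprod (fubini_tonelli2 (fun p : T * T => (sqn (h p.2) * poisson e (p.1 - p.2))%:E))//.
  - apply: eq_integral => x _; rewrite /fubini_G /=.
    under eq_integral => y _ do rewrite EFinM.
    rewrite ge0_integralZl_EFin ?sqn_ge0//; last 2 first.
    + by move=> y _; rewrite lee_fin p0.
    + apply/measurable_EFinP; apply: (measurableT_comp (measurable_poisson e0)).
      exact: measurable_funB.
    by rewrite integral_poisson// mule1.
  - by apply/measurable_EFinP; exact: measurable_funM.
  - by move=> p; rewrite lee_fin mulr_ge0 ?sqn_ge0.
under eq_integral => p _ do rewrite -mulrA EFinM mulrDl EFinD.
rewrite ge0_integralZl_EFin//; last 2 first.
- by move=> p _; rewrite -EFinD lee_fin addr_ge0// mulr_ge0 ?sqn_ge0.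
- by apply: emeasurable_funD; apply/measurable_EFinP; exact: measurable_funM.
rewrite ge0_integralD//; last 4 first.
- by move=> p _; rewrite lee_fin mulr_ge0 ?sqn_ge0.
- by apply/measurable_EFinP; exact: measurable_funM.
- by move=> p _; rewrite lee_fin mulr_ge0 ?sqn_ge0.
- by apply/measurable_EFinP; exact: measurable_funM.
rewrite I1 I2; have [->//|r] : N2 leb h = +oo%E \/ exists r, N2 leb h = r%:E.
- have := N2_ge0 leb h; case: (N2 leb h) => [r _|_|//]; [by right; exists r|by left].
- by rewrite mulry gtr0_sg// mul1e.
- by case: r => r ->; rewrite -EFinD -EFinM; congr EFin; field.
Qed.

(** Since the kernel is nonnegative, [Re (h(s) conj h(t))] may be replaced by the mean of the two
    squared moduli. *)
Lemma expdecay_ft_le (e : R) : 0 < e ->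
  (\int[leb]_w (expdecay e w * sqn (ft leb theta1 h w))%:E <= N2 leb h)%E.
Proof.
move=> e0; have [ik ->] := expdecay_ft e0.
rewrite -(integral_sqn_poisson e0) /Rintegral fineK; last exact: integrable_fin_num.
apply: le_trans (lee_abs _) _; apply: le_trans (le_abse_integral _ _ _) _ => //.
  by case/integrableP : ik.
apply: ge0_le_integral => //.
- by apply: measurableT_comp => //; case/integrableP : ik.
- have ms : measurable_fun setT (fun x => sqn (h x)) by exact: measurable_sqn.
  apply/measurable_EFinP; apply: measurable_funM.
    apply: measurable_funM => //; apply: measurable_funD.
      exact: (measurableT_comp ms measurable_fst).
    exact: (measurableT_comp ms measurable_snd).
  by apply: (measurableT_comp (measurable_poisson e0)); apply: measurable_funB.
move=> p _ /=; rewrite lee_fin normrM (ger0_norm (poisson_ge0 _ e0)).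
by rewrite ler_wpM2r ?poisson_ge0// normRe_mulJ_le.
Qed.

(** The damping factors increase to 1, so monotone convergence applies even if the limit is
    infinite. *)
Lemma expdecay_ft_cvg :
  (\int[leb]_w (expdecay n.+1%:R^-1 w * sqn (ft leb theta1 h w))%:E)%E @[n --> \oo]
  --> N2 leb (ft leb theta1 h).
Proof.
have e0 n : (0 : R) < n.+1%:R^-1 by [].
have lim1 w : (expdecay n.+1%:R^-1 w * sqn (ft leb theta1 h w))%:E @[n --> \oo]
    --> (sqn (ft leb theta1 h w))%:E.
  apply: cvg_EFin; first exact: nearW.
  rewrite -[X in _ --> X]mul1r; apply: cvgM; last exact: cvg_cst.
  have E : expR (- (0 * `|w|)) = 1 :> R by rewrite mul0r oppr0 expR0.
  rewrite -[X in _ --> X]E.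
  apply: (cvg_comp (fun n : nat => - (n.+1%:R^-1 * `|w|)) (@expR R)).
    by apply: cvgN; apply: cvgM; [exact: cvg_harmonic|exact: cvg_cst].
  exact: continuous_expR.
rewrite /N2 (_ : (fun w => (sqn (ft leb theta1 h w))%:E) =
  fun w => limn (fun n => (expdecay n.+1%:R^-1 w * sqn (ft leb theta1 h w))%:E)).
  2: by apply/funext => w; apply/esym/cvg_lim.
apply: cvg_monotone_convergence => //.
- move=> n; apply/measurable_EFinP; apply: measurable_funM.
    exact: measurable_expdecay.
  exact: measurable_sqn.
- by move=> n x _; rewrite lee_fin mulr_ge0 ?sqn_ge0 ?expR_ge0.
- move=> x _ m n mn; rewrite lee_fin ler_wpM2r ?sqn_ge0// ler_expR lerN2.
  by rewrite ler_wpM2r// lef_pV2 ?posrE// ler_nat.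
Qed.

Lemma N2_ft1_le : (N2 leb (ft leb theta1 h) <= N2 leb h)%E.
Proof.
have := expdecay_ft_cvg; move=> /cvg_lim <- //; apply: lime_le.
  by apply/cvg_ex; eexists; exact: expdecay_ft_cvg.
by apply: nearW => n; apply: expdecay_ft_le.
Qed.

End PoissonFormula.

Lemma N2_cvg0 d (T : measurableType d) {R : realType} (mu : {measure set T -> \bar R})
    (u : nat -> T -> R[i]) (g : T -> \bar R) :
  (forall n, cmeasurable (u n)) -> mu.-integrable setT g ->
  (forall n x, (sqn (u n x))%:E <= g x)%E ->
  {ae mu, forall x, sqn (u n x) @[n --> \oo] --> (0 : R)} ->
  N2 mu (u n) @[n --> \oo] --> 0%E.
Proof.
move=> mu_ gi ug u0.
have m1 n : measurable_fun setT (fun x => (sqn (u n x))%:E).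
  by apply/measurable_EFinP; exact: measurable_sqn.
have m0 : measurable_fun setT (cst 0%E : T -> \bar R) by exact: measurable_cst.
have c1 : {ae mu, forall x, setT x -> (sqn (u n x))%:E @[n --> \oo] --> (cst 0%E : T -> \bar R) x}.
  by apply: filterS u0 => x h _; apply: cvg_EFin => //; exact: nearW.
have b1 : {ae mu, forall x n, setT x -> (`|(sqn (u n x))%:E| <= g x)%E}.
  by apply/nearW => x n _; rewrite gee0_abs ?lee_fin ?sqn_ge0.
by have [_ _] := dominated_convergence measurableT m1 m0 c1 gi b1; rewrite integral0.
Qed.

(** * Plancherel for continuous functions of compact support *)

Section CompactSupport.
Context {R : realType}.
Local Notation leb := (@lebesgue_measure R).
Local Notation T := (measurableTypeR R).
Local Notation C x := (real_complex R x).
Local Notation Re := complex.Re.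
Local Notation Im := complex.Im.

Variables (h : T -> R[i]) (M A : R).
Hypothesis mh : cmeasurable h.
Hypothesis hM : forall x, sqn (h x) <= M.
Hypothesis hA : forall x, A < `|x| -> h x = 0.

Let I := `[- A, A]%classic : set T.

Let M0 : 0 <= M. Proof. exact: le_trans (sqn_ge0 _) (hM 0). Qed.

Let I1 : leb.-integrable setT (EFin \o (fun x => \1_I x : R)).
Proof. exact: integrable_indic_itv. Qed.

Let hI x : \1_I x = 0 :> R -> h x = 0.
Proof.
rewrite indicE; case: (boolP (x \in I)) => [_ /eqP|]; first by rewrite oner_eq0.
move=> xI _; apply: hA; rewrite ltNge; apply: contra xI.
by rewrite inE /I /= in_itv /= ler_norml.
Qed.

Lemma cintegrable_cpt : cintegrable leb h.
Proof.
have i2 : leb.-integrable setT (fun x => (Num.sqrt M)%:E * (EFin \o (fun x => \1_I x : R)) x)%E.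
  exact: integrableZl.
apply: (cintegrable_le mh i2) => x; rewrite /= -EFinM lee_fin normcE.
have [x1|x1] := eqVneq (\1_I x : R) 0.
  by rewrite (hI x1) sqn0 sqrtr0 x1 mulr0.
have -> : \1_I x = 1 :> R.
  by move: x1; rewrite indicE; case: (_ \in _) => //; rewrite eqxx.
by rewrite mulr1 ler_sqrt.
Qed.

(** An integrable majorant of all [Psi b]: the unshifted copy of [h] confines [z.1] to the support,
    and the Cauchy density controls [z.2]. *)
Let dominating (z : T * T) : R := (M * \1_I z.1) * cauchy z.2.

Let dominating_integrable : (sfprod leb leb).-integrable setT (EFin \o dominating).
Proof.
have i1 : cintegrable leb (fun x : T => C (M * \1_I x)).
  by apply: cintegrable_real; rewrite (_ : _ \o _ = (fun x => M%:E *
    (EFin \o (fun x => \1_I x : R)) x)%E)//; exact: integrableZl.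
have i2 : cintegrable leb (fun x : T => C (cauchy x)).
  apply: cintegrable_real; apply/integrableP; split.
    by apply/measurable_EFinP; exact: measurable_cauchy.
  under eq_integral => x _ do rewrite /= ger0_norm ?cauchy_ge0//.
  by rewrite integral_cauchy ltry.
have [+ _] := cintegrable_tensor i1 i2.
by congr (_.-integrable _ _); apply/funext => z; rewrite /= mul0r subr0.
Qed.

(** The autocorrelation integrand after rescaling. The parameter is moved from the kernel, which
    concentrates as [e] tends to 0, into the shift of [h]; this is what makes dominated convergence
    possible. *)
Let Psi (b : R) (z : T * T) : R := Re (h (z.1 + b * z.2) * conjc (h z.1)) * cauchy z.2.

Let mshift (b : R) : measurable_fun setT (fun z : T * T => z.1 + b * z.2 : T).
Proof. by apply: measurable_funD => //; apply: measurable_funM. Qed.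

Let mPsi b : measurable_fun setT (Psi b).
Proof.
apply: measurable_funM; last exact: measurableT_comp measurable_cauchy measurable_snd.
have : cmeasurable (fun z : T * T => h (z.1 + b * z.2) * conjc (h z.1)).
  apply: cmeasurableM; first exact: (cmeasurable_comp (mshift b) mh).
  by apply: cmeasurableJ; exact: (cmeasurable_comp measurable_fst mh).
by case.
Qed.

Let Re_le s t : `|Re (h t * conjc (h s))| <= M * \1_I s.
Proof.
have [x1|x1] := eqVneq (\1_I s : R) 0.
  by rewrite (hI x1) complexE /= oppr0 !mulr0 subr0 normr0 x1 mulr0.
have -> : \1_I s = 1 :> R.
  by move: x1; rewrite indicE; case: (_ \in _) => //; rewrite eqxx.
rewrite mulr1 (le_trans (normRe_mulJ_le _ _))//.
by have := hM s; have := hM t; lra.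
Qed.

Let Psi_le b z : `|Psi b z| <= dominating z.
Proof.
by rewrite normrM (ger0_norm (cauchy_ge0 _)) ler_wpM2r ?cauchy_ge0.
Qed.

Let Psi_integrable b : (sfprod leb leb).-integrable setT (EFin \o Psi b).
Proof.
apply: le_integrable dominating_integrable => //; first exact/measurable_EFinP.
by move=> z _ /=; rewrite lee_fin (le_trans (Psi_le _ _))// ler_norm.
Qed.

(** Substitution [t = s + b y] with [b = e / (2 pi)] in the first variable, for fixed [s]; the
    Jacobian cancels the factor [2 pi / e] of [poisson_scale]. *)
Lemma poisson_autocorrelation (e : R) : 0 < e ->
  (\int[sfprod leb leb]_p (Re (h p.1 * conjc (h p.2)) * poisson e (p.1 - p.2)))%:E =
  (\int[sfprod leb leb]_z (Psi (e / (2 * pi)) z)%:E)%E.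
Proof.
move=> e0; have p0 : 0 < pi :> R := pi_gt0 R.
have b0 : 0 < e / (2 * pi) by rewrite divr_gt0// mulr_gt0.
have [ip _] := expdecay_ft cintegrable_cpt e0.
rewrite /Rintegral fineK; last exact: integrable_fin_num.
rewrite -(integral21_prod_meas1 ip) -(integral12_prod_meas1 (Psi_integrable _)).
apply: eq_integral => s _; rewrite /fubini_G /fubini_F.
pose phi (t : T) : R := Re (h t * conjc (h s)) * poisson e (t - s).
have mpoi : measurable_fun setT (fun t : T => poisson e (t - s)).
  by apply: (measurableT_comp (measurable_poisson e0)); apply: measurable_funB.
have iphi : leb.-integrable setT (EFin \o phi).
  have ipoi : leb.-integrable setT (fun t => (M * \1_I s)%:E * (poisson e (t - s))%:E)%E.
    apply: integrableZl => //; apply/integrableP; split; first exact/measurable_EFinP.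
    under eq_integral => x _ do rewrite /= ger0_norm ?poisson_ge0//.
    by rewrite integral_poisson// ltry.
  apply: le_integrable ipoi => //.
    apply/measurable_EFinP; apply: measurable_funM => //.
    have [+ _] : cmeasurable (fun t => h t * conjc (h s)).
      by apply: cmeasurableM => //; exact: cmeasurable_cst.
    exact.
  move=> t _; rewrite /= lee_fin /phi normrM [leRHS]normrM (ger0_norm (poisson_ge0 _ e0)).
  by rewrite ler_wpM2r ?poisson_ge0// (le_trans (Re_le _ _))// ler_norm.
have maff := measurable_affine (e / (2 * pi)) s.
have haff (f : T -> \bar R) : measurable_fun setT f -> (forall x, 0 <= f x)%E ->
   (\int[leb]_x f (s + (e / (2 * pi)) * x)%R = (e / (2 * pi))^-1%:E * \int[leb]_x f x)%E.
  exact: lebesgue_affine_pos.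
have c0 : 0 <= (e / (2 * pi))^-1 by rewrite invr_ge0 ltW.
have [i3 E] := integrable_pushforwardE maff c0 haff iphi.
have -> : (\int[leb]_t (phi t)%:E = (e / (2 * pi))%:E * ((e / (2 * pi))^-1%:E * \int[leb]_x (EFin \o phi) x))%E.
  by rewrite muleA -EFinM divff ?gt_eqF// mul1e.
rewrite -E -(integralZl measurableT i3).
apply: eq_integral => y _; rewrite /= /phi /Psi /= poisson_scale// -EFinM; congr EFin.
set X := Re _; move: X (cauchy y) => X c.
move: (pi : R) p0 => p p0; field.
by rewrite !gt_eqF.
Qed.

Hypothesis cRe : continuous (fun x : R => Re (h x)).
Hypothesis cIm : continuous (fun x : R => Im (h x)).

Let integral_Psi0 : (\int[sfprod leb leb]_z (Psi 0 z)%:E = N2 leb h)%E.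
Proof.
have E z : Psi 0 z = sqn (h z.1) * cauchy z.2.
  by rewrite /Psi mul0r addr0 complexE /sqn !complexE; ring.
under eq_integral => z _ do rewrite E.
have mE : measurable_fun setT (fun z : T * T => sqn (h z.1) * cauchy z.2).
  apply: measurable_funM; last exact: measurableT_comp measurable_cauchy measurable_snd.
  exact: measurableT_comp (measurable_sqn mh) measurable_fst.
rewrite /sfprod (fubini_tonelli1 (fun z : T * T => (sqn (h z.1) * cauchy z.2)%:E))//.
- apply: eq_integral => x _; rewrite /fubini_F /=.
  under eq_integral => y _ do rewrite EFinM.
  rewrite ge0_integralZl_EFin ?sqn_ge0//; last 2 first.
  + by move=> y _; rewrite lee_fin cauchy_ge0.
  + by apply/measurable_EFinP; exact: measurable_cauchy.
  by rewrite integral_cauchy mule1.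
- exact/measurable_EFinP.
- by move=> z; rewrite lee_fin mulr_ge0 ?sqn_ge0 ?cauchy_ge0.
Qed.

(** The damped energies have two limits: the norm of the transform, by monotone convergence, and the
    integral of [Psi 0], by dominated convergence, where continuity of [h] gives the pointwise
    limit. The Cauchy density having mass one, the latter is [N2 leb h]. *)
Lemma plancherel_cpt : N2 leb (ft leb theta1 h) = N2 leb h.
Proof.
have := expdecay_ft_cvg cintegrable_cpt.
rewrite (_ : (fun n => _) = fun n : nat =>
    (\int[sfprod leb leb]_z (Psi (n.+1%:R^-1 / (2 * pi)) z)%:E)%E); last first.
  apply/funext => n; have e0 : (0 : R) < n.+1%:R^-1 by [].
  by have [_ ->] := expdecay_ft cintegrable_cpt e0; rewrite poisson_autocorrelation.
move=> /cvg_lim <- //; apply/cvg_lim => //; rewrite -integral_Psi0.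
have m1 n : measurable_fun setT (fun z => (Psi (n.+1%:R^-1 / (2 * pi)) z)%:E).
  exact/measurable_EFinP.
have m0 : measurable_fun setT (fun z => (Psi 0 z)%:E) by exact/measurable_EFinP.
have b0 : n.+1%:R^-1 / (2 * pi) @[n --> \oo] --> (0 : R).
  by rewrite -[X in _ --> X](mul0r (2 * pi)^-1); apply: cvgM;
    [exact: cvg_harmonic|exact: cvg_cst].
have c1 : {ae sfprod leb leb, forall z, setT z ->
    (Psi (n.+1%:R^-1 / (2 * pi)) z)%:E @[n --> \oo] --> (Psi 0 z)%:E}.
  apply/nearW => z _; apply: cvg_EFin; first exact: nearW.
  apply: cvgM; last exact: cvg_cst.
  have sh : (z.1 + n.+1%:R^-1 / (2 * pi) * z.2) @[n --> \oo] --> (z.1 + 0 * z.2 : R).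
    by apply: cvgD; [exact: cvg_cst|apply: cvgM => //; exact: cvg_cst].
  under eq_fun do rewrite complexE; rewrite complexE; apply: cvgB.
    apply: cvgM; last exact: cvg_cst.
    by apply: (cvg_comp _ (fun x : R => Re (h x)) sh); exact: cRe.
  apply: cvgM; last exact: cvg_cst.
  by apply: (cvg_comp _ (fun x : R => Im (h x)) sh); exact: cIm.
have b1 : {ae sfprod leb leb, forall z n, setT z ->
    (`|(Psi (n.+1%:R^-1 / (2 * pi)) z)%:E| <= (EFin \o dominating) z)%E}.
  by apply/nearW => z n _; rewrite lee_fin.
by have [_ _] := dominated_convergence measurableT m1 m0 c1 dominating_integrable b1.
Qed.

End CompactSupport.

(** * Square-mean approximation by continuous functions of compact support *)

Section Density.
Context {R : realType}.
Local Notation leb := (@lebesgue_measure R).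
Local Notation T := (measurableTypeR R).
Local Notation C x := (real_complex R x).
Local Notation Re := complex.Re.
Local Notation Im := complex.Im.

Let maxr_continuous (f g : R -> R) : continuous f -> continuous g ->
  continuous (fun x => Num.max (f x) (g x)).
Proof. by move=> cf cg x; apply: (continuous_max (cf x) (cg x)). Qed.

Let minr_continuous (f g : R -> R) : continuous f -> continuous g ->
  continuous (fun x => Num.min (f x) (g x)).
Proof. by move=> cf cg x; apply: (continuous_min (cf x) (cg x)). Qed.

(** Continuous functions approximate [u] in [L^1] on a bounded interval. Once the approximant is
    also bounded by [B], the inequality [|u - v|^2 <= 2 B |u - v|] turns this into approximation in
    [L^2]. *)
Lemma approx_bounded_real (u : T -> R) (B M delta : R) : measurable_fun setT u ->
  (forall x, `|u x| <= B) -> (forall x, M < `|x| -> u x = 0) -> 0 < delta ->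
  exists v : R -> R, [/\ continuous v, forall x, `|v x| <= B,
    forall x, M + 1 < `|x| -> v x = 0 &
    (\int[leb]_x ((u x - v x) ^+ 2)%:E < delta%:E)%E].
Proof.
move=> mu uB uM d0; have B0 : 0 <= B := le_trans (normr_ge0 _) (uB 0).
pose E : set T := `[- (M + 1), M + 1]%classic.
have mE : measurable E by exact: measurable_itv.
have Eoo : (leb E < +oo)%E.
  by rewrite /E lebesgue_measure_itv /=; case: ifPn => _; rewrite ?ltry.
have iu : leb.-integrable E (EFin \o u).
  apply: measurable_bounded_integrable => //; first exact: measurable_funTS.
  exists B; split; first exact: num_real.
  by move=> x Bx y _ /=; rewrite (le_trans (uB _))// ltW.
have [g [cg ig /fine_cvgP[gfin g0]]] := approximation_continuous_integrable mE Eoo iu.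
(* The error will be multiplied by [2 * B]; the added 1 keeps the divisor positive when [B = 0]. *)
have d1 : 0 < delta / (2 * B + 1) by rewrite divr_gt0// ltr_wpDl// mulr_ge0.
move/cvgrPdist_lt : g0 => /(_ _ d1) g0.
have [n [n1 n2]] : exists n, (\int[leb]_(z in E) `|(u z - g n z)%:E|)%E \is a fin_num /\
    `|0 - fine (\int[leb]_(z in E) `|(u z - g n z)%:E|)%E| < delta / (2 * B + 1).
  have [n _ Hn] := filterI gfin g0; exists n.
  by have [] := Hn n (leqnn n).
(* Clipping to [[-B, B]], where [u] takes its values, does not increase the distance to [u]; [chi]
   is a continuous cut-off, equal to 1 for [|x| <= M] and to 0 for [|x| >= M + 1]. *)
pose clip (y : R) := Num.max (- B) (Num.min B y).
pose chi (x : R) := Num.max 0 (Num.min 1 (M + 1 - `|x|)).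
have clipB y : `|clip y| <= B.
  rewrite ler_norml /clip le_max lexx /= ge_max.
  by rewrite ge_min lexx /= andbT (le_trans _ B0)// oppr_le0.
have chi01 x : 0 <= chi x <= 1.
  by rewrite /chi le_max lexx /= ge_max ler01 /= ge_min lexx.
have cv : continuous (fun x => chi x * clip (g n x)).
  have cchi : continuous chi.
    apply: maxr_continuous.
      by move=> x; exact: cvg_cst.
    apply: minr_continuous.
      by move=> x; exact: cvg_cst.
    by move=> x; apply: cvgB; [exact: cvg_cst|exact: norm_continuous].
  have cclip : continuous (fun x => clip (g n x)).
    apply: maxr_continuous.
      by move=> x; exact: cvg_cst.
    by apply: minr_continuous => // x; exact: cvg_cst.
  by move=> x; apply: cvgM; [exact: cchi|exact: cclip].
exists (fun x => chi x * clip (g n x)); split=> //.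
- move=> x; have /andP[c0 c1] := chi01 x.
  rewrite normrM (ger0_norm c0) -[leRHS]mul1r ler_pM//.
- move=> x Mx; rewrite (_ : chi x = 0) ?mul0r//.
  by rewrite /chi; apply/max_idPl; rewrite ge_min subr_le0 (ltW Mx) orbT.
have clip_le x : `|u x - clip (g n x)| <= `|u x - g n x|.
  have := uB x; rewrite ler_norml => /andP[u1 u2].
  rewrite /clip; case: (leP B (g n x)) => h1.
    by rewrite max_r ?(le_trans u1 u2)// ler0_norm ?ler0_norm; lra.
  case: (leP (- B) (g n x)) => // h2.
  by rewrite ger0_norm ?ger0_norm; lra.
have clip0 x : `|clip (g n x)| <= `|g n x|.
  rewrite /clip; case: (leP B (g n x)) => h1.
    by rewrite max_r ?(ger0_norm B0) ?(le_trans h1) ?ler_norm//; lra.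
  case: (leP (- B) (g n x)) => // h2.
  by rewrite normrN (ger0_norm B0) ler0_norm; lra.
(* Outside [E] both functions vanish. In the transition zone [u] is 0, so that the cut-off can only
   reduce the error. *)
have key x : (u x - chi x * clip (g n x)) ^+ 2 <= 2 * B * (`|u x - g n x| * \1_E x).
  rewrite indicE; case: (boolP (x \in E)) => xE; last first.
    have Mx : M + 1 < `|x|.
      rewrite ltNge; apply: contra xE.
      by rewrite inE /E /= in_itv /= ler_norml.
    rewrite uM ?(lt_trans _ Mx)// ?ltrDl//.
    rewrite (_ : chi x = 0); first by rewrite mul0r subr0 expr0n /= !mulr0.
    by rewrite /chi; apply/max_idPl; rewrite ge_min subr_le0 (ltW Mx) orbT.
  have /andP[c0 c1] := chi01 x.
  rewrite mulr1 -[leLHS]ger0_norm ?sqr_ge0// expr2 normrM ler_pM//.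
    rewrite (le_trans (ler_normB _ _))// mulr_natl mulr2n lerD//.
    by rewrite normrM (ger0_norm c0) -[leRHS]mul1r ler_pM.
  have [xM|Mx] := leP `|x| M.
    rewrite (_ : chi x = 1) ?mul1r//.
    by rewrite /chi min_l ?max_r//; lra.
  rewrite uM// !sub0r !normrN normrM (ger0_norm c0).
  by rewrite (le_trans _ (clip0 _))// ler_piMl.
have mgn : measurable_fun setT (g n) by exact: continuous_measurable_fun.
have mabs : measurable_fun setT (fun x => `|u x - g n x| * \1_E x).
  apply: measurable_funM; last exact: measurable_indic.
  by apply: measurableT_comp => //; exact: measurable_funB.
apply: (@le_lt_trans _ _ (\int[leb]_x (2 * B * (`|u x - g n x| * \1_E x))%:E)%E).
  apply: ge0_le_integral => //.
  - by move=> x _; rewrite lee_fin sqr_ge0.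
  - apply/measurable_EFinP; apply: measurable_funX; apply: measurable_funB => //.
    exact: continuous_measurable_fun.
  - by apply/measurable_EFinP; apply: measurable_funM.
  - by move=> x _; rewrite lee_fin.
under eq_integral => x _ do rewrite EFinM.
rewrite ge0_integralZl_EFin ?mulr_ge0//; last exact/measurable_EFinP.
have -> : (\int[leb]_x (`|u x - g n x| * \1_E x)%:E =
    \int[leb]_(z in E) `|(u z - g n z)%:E|)%E.
  rewrite [RHS]integral_mkcond; apply: eq_integral => x _.
  by rewrite patchE indicE; case: (_ \in _); rewrite ?mulr1 ?mulr0.
rewrite -(fineK n1) -EFinM lte_fin.
move: n2; rewrite sub0r normrN ltr_pdivlMr ?ltr_wpDl ?mulr_ge0//.
set I := fine _ => HI.
have I0 : 0 <= I by apply: fine_ge0; apply: integral_ge0.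
by move: HI; rewrite (ger0_norm I0); nra.
Qed.

End Density.

(** * From the dense class to all integrable and square integrable functions on the line *)

Section Plancherel1.
Context {R : realType}.
Local Notation leb := (@lebesgue_measure R).
Local Notation T := (measurableTypeR R).
Local Notation C x := (real_complex R x).
Local Notation Re := complex.Re.
Local Notation Im := complex.Im.
Implicit Types h k : T -> R[i].

(** Cutting to the set where both [|x|] and [sqn (h x)] are at most [n] lets one constant bound
    height and radius; the remainder is dominated by [sqn h] and eventually zero at each point. *)
Lemma truncation h (delta : R) : cmeasurable h -> (N2 leb h < +oo)%E -> 0 < delta ->
  exists h' M, [/\ cmeasurable h', forall x, sqn (h' x) <= M,
    forall x, M < `|x| -> h' x = 0 & (N2 leb (fun x => (h x - h' x)%R) < delta%:E)%E].
Proof.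
move=> mh h2 d0.
pose B (n : nat) : set T := [set x | (`|x| <= n%:R) && (sqn (h x) <= n%:R)].
have mle (f : T -> R) c : measurable_fun setT f -> measurable [set x | f x <= c].
  move=> mf; rewrite (_ : [set x | _] = setT `&` f @^-1` `]-oo, c]%classic).
    by apply: mf => //; exact: measurable_itv.
  by apply/seteqP; split=> x /=; rewrite in_itv /=; [split|case].
have mB n : measurable (B n).
  rewrite (_ : B n = [set x | `|x| <= n%:R] `&` [set x | sqn (h x) <= n%:R]).
    by apply: measurableI; apply: mle => //; exact: measurable_sqn.
  by apply/seteqP; split=> x; [move=> /andP[]|move=> [x1 x2]; apply/andP].
pose u n x : R[i] := C (\1_(B n) x) * h x.
have mu n : cmeasurable (u n).
  by apply: cmeasurableM => //; apply: cmeasurable_real; exact: measurable_indic.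
have uE n x : (x \in B n -> u n x = h x) /\ (x \notin B n -> u n x = 0).
  by rewrite /u indicE; case: (_ \in _) => /=; rewrite ?mul1r ?mul0r.
have : N2 leb (fun x => h x - u n x) @[n --> \oo] --> 0%E.
  apply: (@N2_cvg0 _ _ _ _ _ (fun x => (sqn (h x))%:E)).
  - by move=> n; exact: cmeasurableB.
  - exact: integrable_sqn.
  - move=> n x; rewrite lee_fin; have [u1 u2] := uE n x.
    have [/u1 ->|/u2 ->] := boolP (x \in B n); last by rewrite subr0.
    by rewrite subrr sqn0 sqn_ge0.
  - apply/nearW => x; apply: cvg_near_cst.
    exists (Num.truncn (Num.max `|x| (sqn (h x)))).+1 => // n /= nx.
    have [u1 _] := uE n x; suff /u1 -> : x \in B n by rewrite subrr sqn0.
    have : Num.max `|x| (sqn (h x)) <= n%:R.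
      by rewrite (le_trans (ltW (truncnS_gt _)))// ler_nat.
    by rewrite ge_max inE /B /=.
move=> /fine_cvgP[fin /cvgrPdist_lt /(_ _ d0) lt].
have [n _ Hn] := filterI fin lt; have [n1 n2] := Hn n (leqnn n).
exists (u n), n%:R; split => //.
- move=> x; have [u1 u2] := uE n x.
  have [xB|xB] := boolP (x \in B n); last by rewrite u2// sqn0.
  by rewrite u1//; move: xB; rewrite inE /B /= => /andP[].
- move=> x nx; have [_ -> //] := uE n x.
  by rewrite notin_setE /B /= => /andP[]; rewrite leNgt nx.
- move: n2; rewrite sub0r normrN -lte_fin; apply: le_lt_trans.
  by rewrite -{1}(fineK n1) lee_fin ler_norm.
Qed.

Lemma continuous_cpt_dense h (delta : R) : cmeasurable h -> (N2 leb h < +oo)%E -> 0 < delta ->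
  exists k M A, [/\ cmeasurable k, forall x, sqn (k x) <= M,
    forall x, A < `|x| -> k x = 0,
    continuous (fun x : R => Re (k x)) /\ continuous (fun x : R => Im (k x)) &
    (N2 leb (fun x => (h x - k x)%R) < delta%:E)%E].
Proof.
(* Three errors of [delta / 8], from the truncation and from the real and imaginary parts, are each
   doubled by [N2D_le]: in total [6 delta / 8]. *)
move=> mh h2 d0; have d8 : 0 < delta / 8 by rewrite divr_gt0.
have [h' [M [mh' hM hA hh']]] := truncation mh h2 d8.
have M0 : 0 <= M := le_trans (sqn_ge0 _) (hM 0).
have bRe x : `|Re (h' x)| <= Num.sqrt M.
  by rewrite (le_trans (normRe_le _))// normcE ler_sqrt.
have bIm x : `|Im (h' x)| <= Num.sqrt M.
  by rewrite (le_trans (normIm_le _))// normcE ler_sqrt.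
have aRe x : M < `|x| -> Re (h' x) = 0 by move=> /hA ->.
have aIm x : M < `|x| -> Im (h' x) = 0 by move=> /hA ->.
have [v1 [c1 b1 a1 l1]] := approx_bounded_real mh'.1 bRe aRe d8.
have [v2 [c2 b2 a2 l2]] := approx_bounded_real mh'.2 bIm aIm d8.
pose k (x : T) : R[i] := Complex (v1 x) (v2 x).
have mk : cmeasurable k by split; apply: continuous_measurable_fun.
exists k, (M + M), (M + 1); split=> //.
- move=> x; rewrite /sqn /k /= -(real_normK (num_real (v1 x))) -(real_normK (num_real (v2 x))).
  rewrite -(sqr_sqrtr M0) lerD// ler_pXn2r ?nnegrE//; exact: sqrtr_ge0.
- by move=> x Ax; rewrite /k a1// a2.
have E : (N2 leb (fun x => (h' x - k x)%R) = \int[leb]_x ((Re (h' x) - v1 x) ^+ 2)%:E +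
   \int[leb]_x ((Im (h' x) - v2 x) ^+ 2)%:E)%E.
  rewrite -ge0_integralD//.
  - by apply: eq_integral => x _; rewrite -EFinD /sqn !complexE.
  - by move=> x _; rewrite lee_fin sqr_ge0.
  - apply/measurable_EFinP; apply: measurable_funX; apply: measurable_funB.
      by case: mh'.
    by case: mk.
  - by move=> x _; rewrite lee_fin sqr_ge0.
  - apply/measurable_EFinP; apply: measurable_funX; apply: measurable_funB.
      by case: mh'.
    by case: mk.
have h'k : (N2 leb (fun x => (h' x - k x)%R) < (delta / 8)%:E + (delta / 8)%:E)%E.
  by rewrite E lteD.
rewrite (_ : (fun x => _) = (fun x => (h x - h' x) + (h' x - k x))); last first.
  by apply/funext => x; rewrite addrA subrK.
apply: le_lt_trans (N2D_le leb (cmeasurableB mh mh') (cmeasurableB mh' mk)) _.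
apply: (@lt_le_trans _ _ (2%:E * (delta / 8)%:E + 2%:E * ((delta / 8)%:E + (delta / 8)%:E))%E).
  by rewrite lteD// lte_pmul2l// fin_numE.
by rewrite -!EFinD lee_fin; lra.
Qed.

(** Young's inequality; the pointwise deficit is [eta^-1 |eta a + (a - b)|^2]. The coefficient of
    [N2 mu a] can be brought close to 1, as an equality of norms requires and the factor 2 of
    [N2D_le] would not allow. *)
Lemma N2_le_approx d (X : measurableType d) (mu : {measure set X -> \bar R})
    (a b : X -> R[i]) (eta : R) : cmeasurable a -> cmeasurable b -> 0 < eta ->
  (N2 mu b <= (1 + eta)%:E * N2 mu a + (1 + eta^-1)%:E * N2 mu (fun x => (a x - b x)%R))%E.
Proof.
move=> ma mb e0; have mab := cmeasurableB ma mb.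
have e1 : 0 <= 1 + eta by rewrite addr_ge0// ltW.
have e2 : 0 <= 1 + eta^-1 by rewrite addr_ge0// invr_ge0 ltW.
have ms f : cmeasurable f -> measurable_fun setT (fun x : X => (sqn (f x))%:E).
  by move=> mf; apply/measurable_EFinP; exact: measurable_sqn.
have s0 (f : X -> R[i]) x : setT x -> (0 <= (sqn (f x))%:E)%E by rewrite lee_fin sqn_ge0.
rewrite /N2 -!ge0_integralZl_EFin//; try exact: ms; try exact: s0.
rewrite -ge0_integralD//; last 4 first.
- by move=> x _; rewrite mule_ge0 ?lee_fin ?sqn_ge0.
- by apply: measurable_funeM; exact: ms.
- by move=> x _; rewrite mule_ge0 ?lee_fin ?sqn_ge0.
- by apply: measurable_funeM; exact: ms.
apply: ge0_le_integral => //.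
- exact: s0.
- exact: ms.
- by apply: emeasurable_funD; apply: measurable_funeM; exact: ms.
move=> x _; rewrite -!EFinM -EFinD lee_fin.
rewrite -subr_ge0 /sqn !complexE.
set a1 := Re (a x); set a2 := Im (a x); set b1 := Re (b x); set b2 := Im (b x).
rewrite (_ : _ - _ = eta^-1 * ((eta * a1 + (a1 - b1)) ^+ 2 + (eta * a2 + (a2 - b2)) ^+ 2)).
  by rewrite mulr_ge0 ?invr_ge0 ?(ltW e0)// addr_ge0 ?sqr_ge0.
by field; rewrite gt_eqF.
Qed.

Lemma plancherel1 : plancherel leb leb (@theta1 R).
Proof.
move=> h hi h2; have mh := cintegrable_measurable hi.
have Yle := N2_ft1_le hi; apply/eqP; rewrite eq_le Yle /=.
have Yoo := le_lt_trans Yle h2.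
have mft f : cintegrable leb f -> cmeasurable (ft leb (@theta1 R) f).
  by move=> fi; apply: (cmeasurable_ft leb (@measurable_theta1 R)); exact: (cintegrable_measurable fi).
(* ft is isometric on k and contracts h - k; the accuracy [eta ^+ 2] of k absorbs the
   factor [1 + eta^-1] of [N2_le_approx]. *)
have main (eta : R) : 0 < eta -> eta <= 1 ->
    (N2 leb h <= N2 leb (ft leb (@theta1 R) h) + eta%:E * (3%:E * N2 leb (ft leb (@theta1 R) h) + 6%:E))%E.
  move=> e0 e1; have d0 : 0 < eta ^+ 2 by rewrite exprn_gt0.
  have [k [M [A [mk kM kA [kRe kIm] hk]]]] := continuous_cpt_dense mh h2 d0.
  have ki := cintegrable_cpt mk kM kA.
  have kE := plancherel_cpt mk kM kA kRe kIm.
  have hki := cintegrableB hi ki.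
  have ftB : ft leb (@theta1 R) (fun x => h x - k x) =
      (fun w => ft leb (@theta1 R) h w - ft leb (@theta1 R) k w).
    apply/funext => w; rewrite /ft -cintegralB.
    - by congr cintegral; apply/funext => x; rewrite mulrBr.
    - apply: cintegrable_expiM => //.
      exact: (measurableT_comp (@measurable_theta1 R) (pair1_measurable w)).
    - apply: cintegrable_expiM => //.
      exact: (measurableT_comp (@measurable_theta1 R) (pair1_measurable w)).
  have D1 : (N2 leb (fun w => (ft leb (@theta1 R) h w - ft leb (@theta1 R) k w)%R) <= (eta ^+ 2)%:E)%E.
    by rewrite -ftB; apply: le_trans (N2_ft1_le hki) _; exact: ltW.
  have S1 := N2_le_approx leb (mft _ hi) (mft _ ki) e0.
  have S2 : (N2 leb h <= (1 + eta)%:E * N2 leb k + (1 + eta^-1)%:E * (eta ^+ 2)%:E)%E.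
    apply: le_trans (N2_le_approx leb mk mh e0) _; rewrite leeD2l//.
    rewrite lee_pmul2l//; last by rewrite lte_fin addr_gt0// invr_gt0.
    rewrite -N2N (_ : (fun x => _) = (fun x => h x - k x)); first exact: ltW.
    by apply/funext => x; rewrite opprB.
  rewrite kE in S1.
  move: S1 S2 D1; set Y := N2 leb (ft leb _ h); set Z := N2 leb (fun w => (ft leb (@theta1 R) h w - ft leb (@theta1 R) k w)%R).
  move: Yoo (N2_ge0 leb (ft leb (@theta1 R) h)) h2 (N2_ge0 leb h) (N2_ge0 leb (fun w => ft leb (@theta1 R) h w - ft leb (@theta1 R) k w)) (N2_ge0 leb k).
  rewrite -/Y -/Z; case: Y => // y _ y0; case: (N2 leb h) => // x _ x0; case: Z => // z z0.
  case: (N2 leb k) => [t t0||] //.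
  rewrite -!EFinM -!EFinD !lee_fin => S1 S2 D1; rewrite lee_fin in y0.
  have E1 : (1 + eta^-1) * eta ^+ 2 = eta ^+ 2 + eta by field; rewrite gt_eqF.
  have S1' : t <= (1 + eta) * y + (eta ^+ 2 + eta).
    rewrite -E1 (le_trans S1)// lerD2l ler_wpM2l// addr_ge0// invr_ge0 ltW//.
  rewrite E1 in S2; apply: le_trans S2 _.
  have : (1 + eta) * t <= (1 + eta) * ((1 + eta) * y + (eta ^+ 2 + eta)).
    by rewrite ler_wpM2l// addr_ge0// ltW.
  have : 0 <= eta * (1 - eta) * y by rewrite !mulr_ge0 ?subr_ge0// ltW.
  by nra.
move: Yoo main (N2_ge0 leb (ft leb (@theta1 R) h)).
case: (N2 leb (ft leb _ h)) => // y _ main y0; rewrite lee_fin in y0.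
move: h2 main (N2_ge0 leb h); case: (N2 leb h) => // x _ main _.
rewrite lee_fin; apply/ler_addgt0Pr => c c0.
(* The error in [main] is [eta * (3 y + 6)], at most [c] for this choice; its 3 and 6 come from
   replacing [eta ^+ 2] by [eta] throughout, which is where [eta <= 1] enters. *)
pose eta := Num.min 1 (c / (3 * y + 6)).
have y6 : 0 < 3 * y + 6 by rewrite ltr_wpDl// mulr_ge0.
have e0 : 0 < eta by rewrite lt_min ltr01 divr_gt0.
have e1 : eta <= 1 by rewrite ge_min lexx.
have := main _ e0 e1; rewrite -?EFinM -!EFinD lee_fin => h1.
rewrite (le_trans h1)// lerD2l -ler_pdivlMr//.
by rewrite ge_min lexx orbT.
Qed.

End Plancherel1.

(** * Inversion and the symplectic Fourier transform *)

Section Inversion.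
Context {R : realType} (d : nat).
Local Notation V := (Rvec R d).
Local Notation lam := (lebesgue_vec R d).
Local Notation Re := complex.Re.

Definition thetan (w t : V) : R := - (2 * pi * vdot w t).
Definition thetap (w t : V) : R := 2 * pi * vdot w t.

Lemma measurable_thetan : measurable_fun setT (fun p : V * V => thetan p.1 p.2).
Proof.
by apply: measurable_funN; apply: measurable_funM => //; exact: measurable_vdot.
Qed.

Lemma measurable_thetap : measurable_fun setT (fun p : V * V => thetap p.1 p.2).
Proof. by apply: measurable_funM => //; exact: measurable_vdot. Qed.

Lemma plancherel_thetan : plancherel lam lam thetan.
Proof. exact: plancherel_vec (@plancherel1 R). Qed.

Lemma plancherel_thetap : plancherel lam lam thetap.
Proof.
rewrite (_ : thetap = fun w t => - thetan w t); last first.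
  by apply/funext => w; apply/funext => t; rewrite /thetan opprK.
apply: plancherelN plancherel_thetan => w.
exact: (measurableT_comp measurable_thetan (pair1_measurable w)).
Qed.

Lemma vdotC (x y : V) : vdot x y = vdot y x.
Proof. by apply: eq_bigr => i _; rewrite mulrC. Qed.

Lemma N2B_polar d' (X : measurableType d') (mu : {measure set X -> \bar R})
    (a b : X -> R[i]) : cmeasurable a -> cmeasurable b ->
  (N2 mu a < +oo)%E -> (N2 mu b < +oo)%E ->
  N2 mu (fun x => a x - b x) =
  (N2 mu a + N2 mu b - (2 * Re (cintegral mu (fun x => (a x * conjc (b x))%R)))%:E)%E.
Proof.
move=> ma mb a2 b2.
have mbJ := cmeasurableJ mb.
have b2J : (N2 mu (fun x => conjc (b x)) < +oo)%E.
  by rewrite (_ : N2 _ _ = N2 mu b)//; apply: eq_integral => x _; rewrite sqnJ.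
have [ic _] := cintegrable_N2M ma mbJ a2 b2J.
have ia := integrable_sqn ma a2; have ib := integrable_sqn mb b2.
have E : ((Re (cintegral mu (fun x => (a x * conjc (b x))%R)))%:E =
    \int[mu]_x (Re (a x * conjc (b x)))%:E)%E.
  by rewrite [LHS]fineK//; exact: integrable_fin_num ic.
rewrite EFinM E.
rewrite -integralZl// -integralD// -integralB//.
- apply: eq_integral => x _ /=; rewrite -!EFinD -?EFinM -?EFinB; congr EFin.
  by rewrite /sqn !complexE; ring.
- exact: integrableD.
- exact: integrableZl.
Qed.

(** Both sides are iterated integrals of the same [F], in the two orders; the conjugate of the
    kernel of [thetan] is that of [thetap] because [vdot] is symmetric. *)
Lemma ft_adjoint (k h : V -> R[i]) : cintegrable lam k -> cintegrable lam h ->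
  cintegral lam (fun s => ft lam thetap k s * conjc (h s)) =
  cintegral lam (fun w => k w * conjc (ft lam thetan h w)).
Proof.
move=> ki hi.
pose F (z : V * V) := expi (thetap z.1 z.2) * (conjc (h z.1) * k z.2).
have Fi : cintegrable (sfprod lam lam) F.
  apply: cintegrable_expiM; first exact: measurable_thetap.
  exact: (cintegrable_tensor (cintegrableJ hi) ki).
have mtp s : measurable_fun setT (thetap s).
  exact: (measurableT_comp measurable_thetap (pair1_measurable s)).
have mtn s : measurable_fun setT (thetan s).
  exact: (measurableT_comp measurable_thetan (pair1_measurable s)).
transitivity (cintegral (sfprod lam lam) F).
  rewrite cFubini1//; congr cintegral; apply/funext => s.
  rewrite /ft mulrC -cintegralZ; last exact: cintegrable_expiM.
  by congr cintegral; apply/funext => w; rewrite /F /= mulrCA.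
rewrite cFubini2//; congr cintegral; apply/funext => w.
rewrite /ft -cintegralJ; last exact: cintegrable_expiM.
rewrite -cintegralZ; last by apply: cintegrableJ; exact: cintegrable_expiM.
congr cintegral; apply/funext => s; rewrite /F /=.
rewrite (_ : thetap s w = - thetan w s) -?conj_expi.
  by apply: complexP; rewrite !complexE; ring.
by rewrite /thetap /thetan vdotC opprK.
Qed.

Lemma ft_inversion (k h : V -> R[i]) : cintegrable lam k -> (N2 lam k < +oo)%E ->
  cintegrable lam h -> (N2 lam h < +oo)%E ->
  N2 lam (fun s => ft lam thetap k s - h s) =
  N2 lam (fun w => k w - ft lam thetan h w).
Proof.
move=> ki k2 hi h2.
have mk := cintegrable_measurable ki; have mh := cintegrable_measurable hi.
have mfk := cmeasurable_ft lam measurable_thetap mk.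
have mfh := cmeasurable_ft lam measurable_thetan mh.
have Ek := plancherel_thetap ki k2; have Eh := plancherel_thetan hi h2.
rewrite !N2B_polar// ?Ek ?Eh// ft_adjoint//.
Qed.

End Inversion.

(** * Plancherel on phase space and uniqueness of the symplectic transform *)

Section SymplecticPlancherel.
Context {R : realType} (d : nat).
Local Notation V := (Rvec R d).
Local Notation lam := (lebesgue_vec R d).
Local Notation phm := (lebesgue_phase R d).

(** In [w = (p, q)], the component [q] is dual to [x] with a positive phase and [p] is dual to
    [omega] with a negative one, whence the exchanged components. *)
Lemma symplectic_fourier_intE (u : phase R d -> R[i]) w :
  symplectic_fourier_int u w =
  ft phm (fun w z => thetap w.1 z.1 + thetan w.2 z.2) u (w.2, w.1).
Proof.
rewrite /symplectic_fourier_int /ft; congr cintegral; apply/funext => z.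
congr (expi _ * _); rewrite /symp /thetap /thetan /= (vdotC z.2) (vdotC z.1); ring.
Qed.

Lemma symplectic_fourier_int_iter (u : phase R d -> R[i]) w : cintegrable phm u ->
  symplectic_fourier_int u w =
  ft lam (@thetap R d) (fun x => ft lam (@thetan R d) (fun o => u (x, o)) w.1) w.2.
Proof.
move=> ui; rewrite symplectic_fourier_intE.
exact: (ft_prod (@measurable_thetap R d) (@measurable_thetan R d) ui).
Qed.

Lemma N2_symplectic_fourier_int (u : phase R d -> R[i]) : cintegrable phm u ->
  (N2 phm u < +oo)%E -> N2 phm (symplectic_fourier_int u) = N2 phm u.
Proof.
move=> ui u2.
rewrite -(plancherel_prod_swap (@measurable_thetap R d) (@measurable_thetan R d)
  (@plancherel_thetap R d) (@plancherel_thetan R d) ui u2).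
by apply: eq_integral => w _; rewrite symplectic_fourier_intE.
Qed.

Lemma cmeasurable_symplectic_fourier_int (u : phase R d -> R[i]) : cmeasurable u ->
  cmeasurable (symplectic_fourier_int u).
Proof.
move=> mu.
have := cmeasurable_ft phm (measurable_theta_prod (@measurable_thetap R d) (@measurable_thetan R d)) mu.
move=> mf.
rewrite (_ : symplectic_fourier_int u = fun w => ft phm
  (fun w z => thetap w.1 z.1 + thetan w.2 z.2) u (w.2, w.1)).
  apply: (cmeasurable_comp (phi := fun w : phase R d => (w.2, w.1)) _ mf).
  exact: measurable_fun_pair.
by apply/funext => w; rewrite symplectic_fourier_intE.
Qed.

Lemma symplectic_fourier_intB (u v : phase R d -> R[i]) w : cintegrable phm u ->
  cintegrable phm v -> symplectic_fourier_int (fun z => u z - v z) w =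
  symplectic_fourier_int u w - symplectic_fourier_int v w.
Proof.
move=> ui vi.
have ms : measurable_fun setT (fun z : phase R d => - (2 * pi * symp z w)).
  apply: measurable_funN; apply: measurable_funM => //.
  by apply: measurable_funB; apply: measurable_vdot.
rewrite /symplectic_fourier_int -cintegralB; [|exact: cintegrable_expiM..].
by congr cintegral; apply/funext => z; rewrite mulrBr.
Qed.

(** The transforms of two approximating sequences are, by Plancherel, as far apart as the sequences
    themselves, and both sequences tend to [F]. The [bound] is independent of [n] on the left and
    tends to 0 on the right. *)
Lemma is_symplectic_fourier_unique (F H1 H2 : phase R d -> R[i]) :
  is_symplectic_fourier F H1 -> is_symplectic_fourier F H2 ->
  N2 phm (fun w => H1 w - H2 w) = 0%E.
Proof.
move=> [/cLfun2P[mF F2] /cLfun2P[mH1 H12] [u [uL uF uH]]].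
move=> [_ /cLfun2P[mH2 H22] [v [vL vF vH]]].
move: uF uH vF vH => /cLnorm2_cvg0 uF /cLnorm2_cvg0 uH /cLnorm2_cvg0 vF /cLnorm2_cvg0 vH.
have ui n : cintegrable phm (u n) by have [/cLfun1P] := uL n.
have vi n : cintegrable phm (v n) by have [/cLfun1P] := vL n.
have mu n := cintegrable_measurable (ui n).
have mv n := cintegrable_measurable (vi n).
have u2 n : (N2 phm (u n) < +oo)%E by have [_ /cLfun2P[]] := uL n.
have v2 n : (N2 phm (v n) < +oo)%E by have [_ /cLfun2P[]] := vL n.
have msu n := cmeasurable_symplectic_fourier_int (mu n).
have msv n := cmeasurable_symplectic_fourier_int (mv n).
have bound n : (N2 phm (fun w => (H1 w - H2 w)%R) <=
    2%:E * N2 phm (fun w => (symplectic_fourier_int (u n) w - H1 w)%R) +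
    2%:E * (2%:E * (2%:E * N2 phm (fun w => (u n w - F w)%R) +
                    2%:E * N2 phm (fun w => (v n w - F w)%R)) +
            2%:E * N2 phm (fun w => (symplectic_fourier_int (v n) w - H2 w)%R)))%E.
  rewrite (_ : (fun w => H1 w - H2 w) = fun w =>
    ((symplectic_fourier_int (u n) w - symplectic_fourier_int (v n) w) +
     (symplectic_fourier_int (v n) w - H2 w)) -
    (symplectic_fourier_int (u n) w - H1 w)); last first.
    by apply/funext => w; ring.
  have m1 := cmeasurableB (msu n) (msv n); have m2 := cmeasurableB (msv n) mH2.
  have m3 := cmeasurableB (msu n) mH1.
  have m4 := cmeasurableB (mu n) mF; have m5 := cmeasurableB (mv n) mF.
  apply: le_trans (N2B_le phm (cmeasurableD m1 m2) m3) _.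
  rewrite addeC leeD2l// lee_wpmul2l//.
  apply: le_trans (N2D_le phm m1 m2) _.
  rewrite leeD2r// lee_wpmul2l//.
  rewrite (_ : (fun x => _) = symplectic_fourier_int (fun z => u n z - v n z)); last first.
    by apply/funext => w; rewrite symplectic_fourier_intB.
  rewrite N2_symplectic_fourier_int; last 2 first.
    exact: cintegrableB.
    exact: N2B_lty.
  rewrite (_ : (fun z => _) = fun z => (u n z - F z) - (v n z - F z)); last first.
    by apply/funext => z; ring.
  exact: N2B_le.
apply/eqP; rewrite eq_le N2_ge0 andbT.
have lim0 : (2%:E * N2 phm (fun w => (symplectic_fourier_int (u n) w - H1 w)%R) +
    2%:E * (2%:E * (2%:E * N2 phm (fun w => (u n w - F w)%R) +
                    2%:E * N2 phm (fun w => (v n w - F w)%R)) +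
            2%:E * N2 phm (fun w => (symplectic_fourier_int (v n) w - H2 w)%R)))%E
    @[n --> \oo] --> 0%E.
  have c2 (a : nat -> \bar R) : a n @[n --> \oo] --> 0%E -> (2%:E * a n)%E @[n --> \oo] --> 0%E.
    by move=> a0; rewrite -(mule0 2%:E); apply: cvgeZl.
  have cD (a b : nat -> \bar R) : a n @[n --> \oo] --> 0%E -> b n @[n --> \oo] --> 0%E ->
      (a n + b n)%E @[n --> \oo] --> 0%E.
    by move=> a0 b0; rewrite -[X in _ --> X](adde0 0%E); apply: cvgeD.
  by apply: (cD); apply: (c2) => //; apply: (cD); apply: (c2) => //; apply: (cD); apply: (c2).
move/cvg_lim : (lim0) => <- //; apply: lime_ge; first by apply/cvg_ex; exists 0%E.
exact: nearW.
Qed.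

End SymplecticPlancherel.

(** * The transforms of <g, Tf> and <g, Rf> *)

Section Affine.
Context {R : realType} (d : nat).
Local Notation V := (Rvec R d).
Local Notation lam := (lebesgue_vec R d).
Implicit Types x t p : V.

Definition coordE := (@coord_mkvec R d).

Lemma N2_vaff (a : R) (c : V) (F : V -> R[i]) : a != 0 -> cmeasurable F ->
  N2 lam (fun x => F (vaff a c x)) = ((`|a| ^- d)%:E * N2 lam F)%E.
Proof.
move=> a0 mF; apply: (N2_pushforward (phi := vaff a c)) => // f mf f0.
exact: lebesgue_vec_affine.
Qed.

Lemma vsub_vaffl t : vsub t = vaff (-1) t.
Proof. by apply/funext => x; apply: coordP => i; rewrite !coordE mulN1r. Qed.

Lemma vsub_vaffr x : (@vsub R d)^~ x = vaff 1 (vopp x).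
Proof. by apply/funext => t; apply: coordP => i; rewrite !coordE mul1r addrC. Qed.

Lemma vsub_half_vaff p : (fun x => vsub (vscale 2^-1 x) p) = vaff 2^-1 (vopp p).
Proof. by apply/funext => x; apply: coordP => i; rewrite !coordE addrC. Qed.

Lemma vopp_vaff : @vopp R d = vaff (-1) (mkvec (fun=> 0)).
Proof. by apply/funext => x; apply: coordP => i; rewrite !coordE mulN1r add0r. Qed.

Lemma voppK : involutive (@vopp R d).
Proof. by move=> x; apply: coordP => i; rewrite !coordE opprK. Qed.

Lemma poppK : involutive (@popp R d).
Proof. by case=> x o; rewrite /popp /= !voppK. Qed.

Lemma vdotBr (o x t : V) : vdot o (vsub x t) = vdot o x - vdot o t.
Proof. by rewrite /vdot -sumrB; apply: eq_bigr => i _; rewrite coordE mulrBr. Qed.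

Lemma vdotZr (o x : V) a : vdot o (vscale a x) = a * vdot o x.
Proof. by rewrite /vdot mulr_sumr; apply: eq_bigr => i _; rewrite coordE mulrCA. Qed.

Lemma vdotNr (o x : V) : vdot o (vopp x) = - vdot o x.
Proof. by rewrite /vdot -sumrN; apply: eq_bigr => i _; rewrite coordE mulrN. Qed.

Lemma vdotNl (o x : V) : vdot (vopp o) x = - vdot o x.
Proof. by rewrite vdotC vdotNr vdotC. Qed.

Lemma N2_vsubl t (F : V -> R[i]) : cmeasurable F ->
  N2 lam (fun x => F (vsub t x)) = N2 lam F.
Proof.
move=> mF; rewrite vsub_vaffl N2_vaff ?oppr_eq0 ?oner_eq0//.
by rewrite normrN normr1 expr1n invr1 mul1e.
Qed.

Lemma N2_vsubr x (F : V -> R[i]) : cmeasurable F ->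
  N2 lam (fun t => F (vsub t x)) = N2 lam F.
Proof.
move=> mF; rewrite -[fun t => _]/(F \o ((@vsub R d)^~ x)) vsub_vaffr N2_vaff ?oner_eq0//.
by rewrite normr1 expr1n invr1 mul1e.
Qed.

Lemma N2_vopp (F : V -> R[i]) : cmeasurable F ->
  N2 lam (fun x => F (vopp x)) = N2 lam F.
Proof.
move=> mF; rewrite vopp_vaff N2_vaff ?oppr_eq0 ?oner_eq0//.
by rewrite normrN normr1 expr1n invr1 mul1e.
Qed.

Lemma measurable_popp : measurable_fun setT (@popp R d).
Proof.
by apply: measurable_fun_pair; apply: measurable_vopp;
  [exact: measurable_fst|exact: measurable_snd].
Qed.

Lemma N2_phase1 (F : phase R d -> R[i]) : cmeasurable F ->
  N2 (lebesgue_phase R d) F = (\int[lam]_x N2 lam (fun o => F (x, o)))%E.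
Proof. exact: N2_prod1. Qed.

Lemma N2_phase2 (F : phase R d -> R[i]) : cmeasurable F ->
  N2 (lebesgue_phase R d) F = (\int[lam]_o N2 lam (fun x => F (x, o)))%E.
Proof. exact: N2_prod2. Qed.

Lemma N2_popp (F : phase R d -> R[i]) : cmeasurable F ->
  N2 (lebesgue_phase R d) (fun z => F (popp z)) = N2 (lebesgue_phase R d) F.
Proof.
move=> mF; have mFp := cmeasurable_comp measurable_popp mF.
rewrite (N2_phase1 mFp) (N2_phase1 mF).
transitivity (\int[lam]_x N2 lam (fun o => F (vopp x, o)))%E.
  apply: eq_integral => x _.
  exact: (N2_vopp (cmeasurable_pair1 (vopp x) mF)).
rewrite vopp_vaff.
have mJ := measurable_N2_pair1 lam mF.
rewrite (@lebesgue_vec_affine R d (-1) _ (fun x => N2 lam (fun o => F (x, o))))//.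
  by rewrite normrN normr1 expr1n invr1 mul1e.
by move=> x; exact: N2_ge0.
Qed.

(** The substitution [t = x/2 - p]; its Jacobian is the origin of the constant in the theorem. *)
Lemma cintegral_half p (F : V -> R[i]) : cintegrable lam F ->
  cintegrable lam (fun x => F (vsub (vscale 2^-1 x) p)) /\
  cintegral lam (fun x => F (vsub (vscale 2^-1 x) p)) = 2 ^+ d * cintegral lam F.
Proof.
move=> Fi.
have E (f : V -> \bar R) : measurable_fun setT f -> (forall x, 0 <= f x)%E ->
    (\int[lam]_x f (vaff 2^-1 (vopp p) x) = (2 ^+ d)%:E * \int[lam]_x f x)%E.
  move=> mf f0; rewrite lebesgue_vec_affine ?invr_eq0//.
  by rewrite ger0_norm ?invr_ge0// -exprVn invrK.
have e0 : (0 : R) <= 2 ^+ d by exact: exprn_ge0.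
have mv := measurable_vaff 2^-1 (vopp p).
have := cintegrable_pushforward mv e0 E Fi.
have := cintegral_pushforward mv e0 E Fi.
rewrite -(vsub_half_vaff p) rmorphXn rmorph_nat; split=> //.
Qed.

End Affine.

Lemma conjcM {R : realType} (z w : R[i]) : conjc (z * w) = conjc z * conjc w.
Proof. by apply: complexP; rewrite !complexE; ring. Qed.

(** * The cross-ambiguity function [<g, Tf>] and the cross-Wigner function behind [<g, Rf>] *)

Section Ambiguity.
Context {R : realType} (d : nat).
Local Notation V := (Rvec R d).
Local Notation lam := (lebesgue_vec R d).
Local Notation phm := (lebesgue_phase R d).
Local Notation C x := (real_complex R x).
Variables (f g : V -> R[i]).
Hypothesis (mf : cmeasurable f) (mg : cmeasurable g).
Hypothesis (f2 : (N2 lam f < +oo)%E) (g2 : (N2 lam g < +oo)%E).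

Let h (z : phase R d) : R[i] := g z.2 * conjc (f (vsub z.2 z.1)).

Let mh : cmeasurable h.
Proof.
apply: cmeasurableM; first exact: (cmeasurable_comp measurable_snd mg).
apply: cmeasurableJ; apply: (cmeasurable_comp _ mf).
by apply: measurable_vsub.
Qed.

Let N2J (F : V -> R[i]) : N2 lam (fun x => conjc (F x)) = N2 lam F.
Proof. by apply: eq_integral => x _; rewrite sqnJ. Qed.

(** Integrated in [x] for fixed [t], [sqn h] gives [sqn (g t)] times [N2 lam f], by invariance under
    [x |-> t - x]; the whole is the product of the two squared norms. *)
Let h2 : (N2 phm h < +oo)%E.
Proof.
have gr0 := N2_ge0 lam f.
rewrite (N2_phase2 mh).
under eq_integral => t _.
  have -> : N2 lam (fun x => h (x, t)) = ((sqn (g t))%:E * N2 lam f)%E.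
    rewrite -(N2_vsubl t mf) -ge0_integralZl//.
    - by apply: eq_integral => x _; rewrite /h /= sqnM sqnJ EFinM.
    - apply/measurable_EFinP/measurable_sqn; apply: (cmeasurable_comp _ mf).
      exact: measurable_vsub.
    - by move=> x _; rewrite lee_fin sqn_ge0.
    - by rewrite lee_fin sqn_ge0.
  over.
rewrite ge0_integralZr//; last 2 first.
  by apply/measurable_EFinP; exact: measurable_sqn.
  by move=> t _; rewrite lee_fin sqn_ge0.
by rewrite lte_mul_pinfty ?N2_ge0// ge0_fin_numE ?N2_ge0.
Qed.

(** A product of two square integrable functions, hence integrable for every [x]; for square
    integrability, [ae_h2] provides only almost every [x]. *)
Let hi x : cintegrable lam (fun t => h (x, t)).
Proof.
apply: (cintegrable_N2M (f := g) (g := fun t => conjc (f (vsub t x)))) => //.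
  by apply: cmeasurableJ; apply: (cmeasurable_comp _ mf); exact: measurable_vsub.
by rewrite N2J N2_vsubr.
Qed.

Let ae_h2 : {ae lam, forall x, (N2 lam (fun t => h (x, t)) < +oo)%E}.
Proof. exact: ae_N2_lty1. Qed.

Let A (z : phase R d) : R[i] := inner lam g (heisenberg_weyl f z).

(** The modulation outside the transform comes from the centring [t - x/2] in the phase of the
    Heisenberg-Weyl operator. *)
Let AE z : A z = expi (pi * vdot z.2 z.1) * ft lam (@thetan R d) (fun t => h (z.1, t)) z.2.
Proof.
have mt : measurable_fun setT (@thetan R d z.2).
  exact: (measurableT_comp (@measurable_thetan R d) (pair1_measurable z.2)).
rewrite /A /inner /ft -cintegralZ; last exact: cintegrable_expiM.
congr cintegral; apply/funext => t; rewrite /heisenberg_weyl /h /= conjcM.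
rewrite conj_expi (_ : - _ = pi * vdot z.2 z.1 + thetan z.2 t); first by rewrite expiD; ring.
by rewrite /thetan vdotBr vdotZr; field.
Qed.

Let mFT : cmeasurable (fun z : phase R d => ft lam (@thetan R d) (fun t => h (z.1, t)) z.2).
Proof.
apply: (@cmeasurable_cintegral1 _ _ _ _ _ lam
  (fun p : phase R d * V => expi (thetan p.1.2 p.2) * h (p.1.1, p.2))).
apply: cmeasurableM.
  apply: cmeasurable_expi.
  apply: (measurableT_comp (@measurable_thetan R d) (g := fun p : phase R d * V => (p.1.2, p.2))).
  by apply: measurable_fun_pair => //; exact: (measurableT_comp measurable_snd measurable_fst).
apply: (cmeasurable_comp (f := h) (phi := fun p : phase R d * V => (p.1.1, p.2))) => //.
by apply: measurable_fun_pair => //; exact: (measurableT_comp measurable_fst measurable_fst).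
Qed.

Let mA : cmeasurable A.
Proof.
rewrite (_ : A = fun z => expi (pi * vdot z.2 z.1) *
  ft lam (@thetan R d) (fun t => h (z.1, t)) z.2); last by apply/funext => z; exact: AE.
apply: cmeasurableM => //; apply: cmeasurable_expi; apply: measurable_funM => //.
exact: measurable_vdot.
Qed.

Let A_pair x : N2 lam (fun o => A (x, o)) =
  N2 lam (ft lam (@thetan R d) (fun t => h (x, t))).
Proof. by apply: eq_integral => o _; rewrite AE sqnM sqn_expi mul1r. Qed.

(** The norm form of Moyal's identity: Plancherel in [t] for almost every [x]. *)
Let A2 : N2 phm A = N2 phm h.
Proof.
rewrite (N2_phase1 mA) (N2_phase1 mh); apply: ge0_ae_eq_integral => //; try by move=> x _; exact: N2_ge0.
- exact: measurable_N2_pair1.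
- exact: measurable_N2_pair1.
- apply: filterS ae_h2 => x hx _.
  by rewrite A_pair (plancherel_thetan (hi x) hx).
Qed.

Let k (p x : V) : R[i] := h (x, vsub (vscale 2^-1 x) p).

(** With [t = x/2 - p] one has [t - x = -2p - t]: up to this affine substitution, [k p] is the
    product of [g] with a reflected and conjugated [f]. *)
Let ki p : cintegrable lam (k p).
Proof.
have c0 : cintegrable lam (fun t => g t * conjc (f (vsub (vscale (-2) p) t))).
  apply: (cintegrable_N2M (f := g) (g := fun t => conjc (f (vsub (vscale (-2) p) t)))) => //.
    by apply: cmeasurableJ; apply: (cmeasurable_comp _ mf); exact: measurable_vsub.
  by rewrite N2J N2_vsubl.
have [+ _] := cintegral_half p c0; congr cintegrable.
apply/funext => x; rewrite /k /h /=; congr (_ * conjc (f _)).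
by apply: coordP => i; rewrite !coordE; field.
Qed.

Let H (w : phase R d) : R[i] := 2 ^+ d * inner lam g (grossmann_royer f (popp w)).

(** At [t = x/2 - p] the conjugated Grossmann-Royer phase [4 pi q.(t + p)] becomes [2 pi q.x], and
    the factor [2 ^+ d] in [H] is the Jacobian. *)
Let HE w : H w = ft lam (@thetap R d) (k w.1) w.2.
Proof.
pose Phi t := g t * conjc (grossmann_royer f (popp w) t).
have PhiE t : Phi t = expi (4 * pi * vdot w.2 (vsub t (vopp w.1))) *
    (g t * conjc (f (vsub (vscale (-2) w.1) t))).
  rewrite /Phi /grossmann_royer /= conjcM conj_expi vdotNl mulrN opprK.
  rewrite (_ : vscale 2 (vopp w.1) = vscale (-2) w.1); first by ring.
  by apply: coordP => i; rewrite !coordE mulrN mulNr.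
have Phii : cintegrable lam Phi.
  rewrite (_ : Phi = fun t => expi (4 * pi * vdot w.2 (vsub t (vopp w.1))) *
    (g t * conjc (f (vsub (vscale (-2) w.1) t)))); last exact/funext.
  apply: cintegrable_expiM.
    apply: measurable_funM => //; apply: measurable_vdot => //; exact: measurable_vsub.
  apply: (cintegrable_N2M (f := g) (g := fun t => conjc (f (vsub (vscale (-2) w.1) t)))) => //.
    by apply: cmeasurableJ; apply: (cmeasurable_comp _ mf); exact: measurable_vsub.
  by rewrite N2J N2_vsubl.
have [_ E] := cintegral_half w.1 Phii.
rewrite /H /inner -[LHS]E /ft; congr cintegral; apply/funext => x.
rewrite PhiE /k /h /=; congr (expi _ * (_ * conjc (f _))).
  by rewrite /thetap !vdotBr vdotNr vdotZr; field.
by apply: coordP => i; rewrite !coordE; field.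
Qed.

Let mk2 : cmeasurable (fun z : phase R d => k z.1 z.2).
Proof.
apply: (cmeasurable_comp (f := h)
  (phi := fun z : phase R d => (z.2, vsub (vscale 2^-1 z.2) z.1))) => //.
apply: measurable_fun_pair => //; apply: measurable_vsub => //.
by apply: measurable_vscale.
Qed.

Let k2 : N2 phm (fun z => k z.1 z.2) = N2 phm h.
Proof.
rewrite (N2_phase2 mk2) (N2_phase1 mh); apply: eq_integral => x _.
by rewrite -(N2_vsubl (vscale 2^-1 x) (cmeasurable_pair1 x mh)).
Qed.

Let mH : cmeasurable H.
Proof.
rewrite (_ : H = fun w => ft lam (@thetap R d) (k w.1) w.2); last exact/funext.
apply: (@cmeasurable_cintegral1 _ _ _ _ _ lam
  (fun p : phase R d * V => expi (thetap p.1.2 p.2) * k p.1.1 p.2)).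
apply: cmeasurableM.
  apply: cmeasurable_expi.
  apply: (measurableT_comp (@measurable_thetap R d) (g := fun p : phase R d * V => (p.1.2, p.2))).
  by apply: measurable_fun_pair => //; exact: (measurableT_comp measurable_snd measurable_fst).
apply: (cmeasurable_comp (phi := fun p : phase R d * V => (p.1.1, p.2)) _ mk2).
by apply: measurable_fun_pair => //; exact: (measurableT_comp measurable_fst measurable_fst).
Qed.

Let H2 : (N2 phm H < +oo)%E.
Proof.
apply: (@le_lt_trans _ _ (N2 phm (fun z => k z.1 z.2))); last by rewrite k2.
rewrite (N2_phase1 mH) (N2_phase1 mk2); apply: ge0_le_integral => //.
- by move=> p _; exact: N2_ge0.
- exact: measurable_N2_pair1.
- exact: (measurable_N2_pair1 lam mk2).
(* The contraction form applies for every [p], since it asks only for integrability of [k p]. *)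
move=> p _; apply: le_trans (plancherel_le (@plancherel_thetap R d) (ki p)).
by rewrite le_eqVlt; apply/orP; left; apply/eqP; apply: eq_integral => q _; rewrite HE.
Qed.

Lemma N2_symplectic_fourier_int_sub (u : phase R d -> R[i]) :
  cintegrable phm u -> (N2 phm u < +oo)%E ->
  (N2 phm (fun w => symplectic_fourier_int u w - H w)%R <=
   N2 phm (fun z => u z - A z)%R)%E.
Proof.
move=> ui u2; have mu := cintegrable_measurable ui.
pose B p x := ft lam (@thetan R d) (fun o => u (x, o)) p.
have Bi p : cintegrable lam (B p).
  exact: (cintegrable_ft2 (theta2 := @thetan R d) (@measurable_thetan R d) ui p).
have mB : cmeasurable (fun z : phase R d => B z.1 z.2).
  apply: (@cmeasurable_cintegral1 _ _ _ _ _ lam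
    (fun p : phase R d * V => expi (thetan p.1.1 p.2) * u (p.1.2, p.2))).
  apply: cmeasurableM.
    apply: cmeasurable_expi.
    apply: (measurableT_comp (@measurable_thetan R d) (g := fun p : phase R d * V => (p.1.1, p.2))).
    by apply: measurable_fun_pair => //; exact: (measurableT_comp measurable_fst measurable_fst).
  apply: (cmeasurable_comp (phi := fun p : phase R d * V => (p.1.2, p.2)) _ mu).
  by apply: measurable_fun_pair => //; exact: (measurableT_comp measurable_snd measurable_fst).
have mD := cmeasurableB mB mk2.
have mSH := cmeasurableB (cmeasurable_symplectic_fourier_int mu) mH.
have muA := cmeasurableB mu mA.
have mtp q : measurable_fun setT (@thetap R d q).
  exact: (measurableT_comp (@measurable_thetap R d) (pair1_measurable q)).
(* For fixed [p], both functions are transforms in [x] evaluated at [q], of [B p] and of [k p];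
   undoing this common transform is where the inequality comes from. *)
apply: (@le_trans _ _ (N2 phm (fun z => B z.1 z.2 - k z.1 z.2))).
  rewrite (N2_phase1 mSH) (N2_phase1 mD); apply: ge0_le_integral => //.
  - by move=> p _; exact: N2_ge0.
  - exact: (measurable_N2_pair1 lam mSH).
  - exact: (measurable_N2_pair1 lam mD).
  move=> p _; have := plancherel_le (@plancherel_thetap R d) (cintegrableB (Bi p) (ki p)).
  apply: le_trans; rewrite le_eqVlt; apply/orP; left; apply/eqP.
  apply: eq_integral => q _; congr (sqn _)%:E.
  rewrite HE (symplectic_fourier_int_iter _ ui) /= /ft -cintegralB.
  - by congr cintegral; apply/funext => x; rewrite mulrBr.
  - by apply: cintegrable_expiM => //; exact: Bi.
  - exact: cintegrable_expiM.
(* The rest is an equality: for almost every [x], inversion in the variables [omega] and [p] applies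
   to the sections. *)
rewrite (N2_phase2 mD) (N2_phase1 muA) le_eqVlt; apply/orP; left; apply/eqP.
apply: ge0_ae_eq_integral => //; try by move=> x _; exact: N2_ge0.
- exact: (measurable_N2_pair2 lam mD).
- exact: (measurable_N2_pair1 lam muA).
have aeu : {ae lam, forall x, cintegrable lam (fun o => u (x, o)) /\
    (N2 lam (fun o => u (x, o)) < +oo)%E}.
  by apply: filterS2 (ae_cintegrable1 ui) (ae_N2_lty1 mu u2) => x.
apply: filterS2 ae_h2 aeu => x hx [uxi ux2] _.
(* Removing the modulation [expi (pi * vdot o x)] of A turns evaluation at p into
   evaluation at [x/2 - p]. *)
pose kap o := expi (- (pi * vdot o x)) * u (x, o).
have mpi : measurable_fun setT (fun o : V => pi * vdot o x).
  by apply: measurable_funM => //; exact: measurable_vdot.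
have kapi : cintegrable lam kap.
  by apply: cintegrable_expiM => //; exact: measurable_funN.
have kap2 : (N2 lam kap < +oo)%E.
  rewrite (_ : N2 lam kap = N2 lam (fun o => u (x, o)))//.
  by apply: eq_integral => o _; rewrite sqnM sqn_expi mul1r.
have uE o : u (x, o) = expi (pi * vdot o x) * kap o.
  by rewrite /kap mulrA -expiD subrr expi0 mul1r.
have mE := cmeasurableB (cmeasurable_ft lam (@measurable_thetap R d) (cintegrable_measurable kapi))
  (cmeasurable_pair1 x mh).
transitivity (N2 lam (fun o => kap o - ft lam (@thetan R d) (fun t => h (x, t)) o)).
  rewrite -(ft_inversion kapi kap2 (hi x) hx) -(N2_vsubl (vscale 2^-1 x) mE).
  apply: eq_integral => p _; congr (sqn _)%:E; rewrite /B /= /k; congr (_ - _).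
  rewrite /ft; congr cintegral; apply/funext => o.
  rewrite uE mulrA -expiD; congr (expi _ * _).
  by rewrite /thetan /thetap (vdotC (vsub _ _)) vdotBr vdotZr (vdotC p); field.
apply: eq_integral => o _; rewrite uE AE /= -mulrBr sqnM sqn_expi mul1r//.
Qed.

Lemma is_symplectic_fourier_ambiguity : is_symplectic_fourier A H.
Proof.
have A2oo : (N2 phm A < +oo)%E by rewrite A2.
split; [by apply/cLfun2P|by apply/cLfun2P|].
have /sigma_finiteP[S [ST ndS Soo]] := sigma_finiteT lam.
have mS n : measurable (S n) by have [] := Soo n.
(* Indicator of the product of [S n] with itself: these sets increase to phase space and have finite
   measure. The tensor form passes integrability from the factors to [b n]. *)
pose b n (z : phase R d) : R[i] := C (\1_(S n) z.1) * C (\1_(S n) z.2).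
have iS n : cintegrable lam (fun x => C (\1_(S n) x)).
  split; last exact: integrable0.
  have mI : measurable_fun setT (fun x : V => (\1_(S n) x)%:E : \bar R).
    by apply/measurable_EFinP; exact: measurable_indic.
  apply/integrableP; split => //.
  under eq_integral => x _ do rewrite /= ger0_norm//.
  by rewrite integral_indic// setIT; have [] := Soo n.
have bi n : cintegrable phm (b n) := cintegrable_tensor (iS n) (iS n).
have mb n := cintegrable_measurable (bi n).
have b01 n z : b n z = 1 \/ b n z = 0.
  by rewrite /b !indicE; case: (_ \in _); case: (_ \in _); rewrite ?mulr1 ?mulr0; [left|right..].
have b2 n : (N2 phm (b n) < +oo)%E.
  (* As [b n] takes only the values 0 and 1, its modulus equals its squared modulus. *)
  have /cintegrableP[_] := bi n; congr (_ < _)%E; apply: eq_integral => z _; congr EFin.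
  by rewrite normcE; have [->|->] := b01 n z; rewrite ?sqn0 ?sqrtr0// -expi0 sqn_expi sqrtr1.
pose u n z := b n z * A z.
(* Truncation makes [A] integrable as a product of two square integrable functions. *)
have ui n : cintegrable phm (u n) by apply: cintegrable_N2M.
have mu n := cintegrable_measurable (ui n).
have u2 n : (N2 phm (u n) < +oo)%E.
  apply: le_lt_trans A2oo; apply: (le_N2 phm (mu n) mA) => z; rewrite /u.
  by have [->|->] := b01 n z; rewrite ?mul1r ?mul0r// sqn0 sqn_ge0.
have uA : N2 phm (fun z => u n z - A z) @[n --> \oo] --> 0%E.
  apply: (@N2_cvg0 _ _ _ _ _ (fun z => (sqn (A z))%:E)).
  - by move=> n; exact: (cmeasurableB (mu n) mA).
  - exact: (integrable_sqn mA A2oo).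
  - move=> n z; rewrite lee_fin /u; have [->|->] := b01 n z.
      by rewrite mul1r subrr sqn0 sqn_ge0.
    by rewrite mul0r sub0r sqnN.
  - apply/nearW => z; apply: cvg_near_cst.
    have [i _ Si] : (\bigcup_n S n) z.1 by rewrite -ST.
    have [j _ Sj] : (\bigcup_n S n) z.2 by rewrite -ST.
    exists (maxn i j) => // n /=; rewrite geq_max => /andP[iN jN].
    rewrite /u /b !indicE !mem_set ?mul1r ?subrr ?sqn0//.
      by move: (z.2) Sj; exact/subsetPset/ndS.
    by move: (z.1) Si; exact/subsetPset/ndS.
exists u; split.
- by move=> n; split; [exact: (cLfun1P _ _).2 (ui n)|exact: (cLfun2P _ _).2 (conj (mu n) (u2 n))].
- exact/cLnorm2_cvg0.
- apply/cLnorm2_cvg0.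
  apply: (@squeeze_cvge _ _ _ _ (fun=> 0%E) _ (fun n => N2 phm (fun z => u n z - A z))) => //.
    apply: nearW => n; apply/andP; split; first exact: N2_ge0.
    exact: (N2_symplectic_fourier_int_sub (ui n) (u2 n)).
  exact: cvg_cst.
Qed.

Lemma cLfun_ambiguity : cLfun phm 2%:E A.
Proof. by apply/cLfun2P; rewrite A2. Qed.

Lemma grossmann_royer_ae :
  {ae phm, forall w, inner lam g (grossmann_royer f w) =
    2 ^- d * symplectic_fourier A (popp w)}.
Proof.
(* Since [A] has a transform, the choice made by [xget] is one, and the default value does not
   arise. *)
have sfA : is_symplectic_fourier A (symplectic_fourier A).
  exact: (xgetPex (fun=> 0) (ex_intro _ _ is_symplectic_fourier_ambiguity)).
have N0 := is_symplectic_fourier_unique is_symplectic_fourier_ambiguity sfA.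
have [_ /cLfun2P[msf _] _] := sfA.
have mD := cmeasurableB mH msf.
(* Reflection preserves the measure, so the vanishing of the norm, and with it the almost-everywhere
   identity, can be read at [popp w]. *)
rewrite -(N2_popp mD) in N0.
have mDp := cmeasurable_comp (@measurable_popp R d) mD.
apply: filterS (N2_ae_eq0 mDp N0) => w /= /eqP; rewrite subr_eq0 => /eqP <-.
by rewrite /H poppK mulKf// expf_neq0// pnatr_eq0.
Qed.

End Ambiguity.

Unset Implicit Arguments.

Theorem proposition5 (R : realType) (d : nat) (f g : Rvec R d -> R[i])
    (hf : cLfun (lebesgue_vec R d) 2%:E f)
    (hg : cLfun (lebesgue_vec R d) 2%:E g) :
  let gTf := fun z : phase R d =>
    inner (lebesgue_vec R d) g (heisenberg_weyl f z) in
  cLfun (lebesgue_phase R d) 2%:E gTf /\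
  {ae lebesgue_phase R d, forall w : phase R d,
    inner (lebesgue_vec R d) g (grossmann_royer f w) =
    2 ^- d * symplectic_fourier gTf (popp w)}.
Proof.
move: hf hg => /cLfun2P[mf f2] /cLfun2P[mg g2] gTf.
split; [exact: cLfun_ambiguity|exact: grossmann_royer_ae].
Qed.
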